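(* There exists a universal constant $0<\beta\le 1680e$ such that every symmetric real random variable $X$ with log-concave tails, i.e. such that the function $$N(t):=-\ln \mathbb{P}(|X|\ge t),\qquad t\ge 0,$$ is convex on $[0,\infty)$, satisfies convex $\mathrm{IC}(\beta)$; that is, for every convex function $f:\mathbb{R}\to\mathbb{R}$ bounded from below, $$\mathbb{E}\, e^{(f\,\square\,\varphi)(X)}\;\mathbb{E}\, e^{-f(X)}\le 1,\qquad\text{where } \varphi(x)=\Lambda_X^*(x/\beta).$$
   Context: A random variable $X$ is symmetric if $X$ and $-X$ have the same distribution. The function $N$ takes values in $[0,\infty]$ (with $-\ln 0=+\infty$), and convexity is understood for extended-valued functions. For a random vector $X$ in $\mathbb{R}^n$ (here $n=1$), $\Lambda_X(y)=\ln\mathbb{E}\,e^{\langle y,X\rangle}\in(-\infty,\infty]$ is the cumulant-generating function and $\Lambda_X^*(x)=\sup_{y\in\mathbb{R}^n}\{\langle x,y\rangle-\Lambda_X(y)\}\in[0,\infty]$ is its Legendre transform. For $f:\mathbb{R}^n\to\mathbb{R}$ and $\varphi:\mathbb{R}^n\to[0,\infty]$, the infimum convolution is $(f\,\square\,\varphi)(x)=\inf\{f(y)+\varphi(x-y):y\in\mathbb{R}^n\}$. A pair $(X,\varphi)$ satisfies the convex infimum convolution inequality if $\mathbb{E}\,e^{(f\square\varphi)(X)}\,\mathbb{E}\,e^{-f(X)}\le 1$ for every convex $f:\mathbb{R}^n\to\mathbb{R}$ bounded from below. $X$ satisfies convex $\mathrm{IC}(\beta)$ if the pair $(X,\Lambda_X^*(\cdot/\beta))$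 satisfies the convex infimum convolution inequality. *)

(* Defs.v *)
From HB Require Import structures.
From mathcomp Require Import all_boot all_order all_algebra.
From mathcomp Require Import all_classical all_reals all_analysis.

Set Implicit Arguments.
Unset Strict Implicit.
Unset Printing Implicit Defensive.

Import Order.TTheory GRing.Theory Num.Theory.
Import numFieldNormedType.Exports.

Local Open Scope classical_set_scope.
Local Open Scope ring_scope.
Local Open Scope ereal_scope.

(* Equality of laws is required on measurable sets only: the values of a
   measure on non-measurable sets carry no information. *)
Definition symmetric_RV (d : measure_display) (T : measurableType d)
    (R : realType) (P : probability T R) (X : {RV P >-> R}) : Prop :=
  forall A : set R, measurable A ->
    distribution P X A = pushforward P (\- X)%R A.

(* Convexity on [D] of a function with values in ]-oo, +oo]; at the endpoints
   t = 0, 1 the convention 0 * +oo = 0 makes the inequality trivial. *)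
Definition econvex_function (R : realType) (D : set R) (g : R -> \bar R) : Prop :=
  forall x y t : R, D x -> D y -> (0 <= t <= 1)%R ->
    g (t * x + (1 - t) * y)%R <= t%:E * g x + (1 - t)%:E * g y.

(* [lne 0 = -oo], so this is +oo where the tail probability vanishes. *)
Definition log_tail (d : measure_display) (T : measurableType d)
    (R : realType) (P : probability T R) (X : {RV P >-> R}) (t : R) : \bar R :=
  - lne (P [set w | (t <= `|X w|)%R]).

Definition log_concave_tails (d : measure_display) (T : measurableType d)
    (R : realType) (P : probability T R) (X : {RV P >-> R}) : Prop :=
  econvex_function [set t : R | (0 <= t)%R] (log_tail X).

Definition cumulant_gen_fun (d : measure_display) (T : measurableType d)
    (R : realType) (P : probability T R) (X : {RV P >-> R}) (y : R) : \bar R :=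
  lne (mmt_gen_fun P X y).

Definition legendre (R : realType) (L : R -> \bar R) (x : R) : \bar R :=
  ereal_sup (range (fun y : R => (x * y)%:E - L y)).

Definition inf_conv (R : realType) (f : R -> R) (phi : R -> \bar R) (x : R)
    : \bar R :=
  ereal_inf (range (fun y : R => (f y)%:E + phi (x - y)%R)).

(* The expectations are written as integrals because [expectation] only takes
   real-valued integrands, whereas [inf_conv f phi] is extended-valued. *)
Definition convex_inf_conv_ineq (d : measure_display) (T : measurableType d)
    (R : realType) (P : probability T R) (X : {RV P >-> R})
    (phi : R -> \bar R) : Prop :=
  forall f : R -> R,
    convex_function [set: R^o] f -> has_lbound (range f) ->
    (\int[P]_w expeR (inf_conv f phi (X w))) * (\int[P]_w (expR (- f (X w)))%:E)
      <= 1.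

Definition convex_IC (d : measure_display) (T : measurableType d)
    (R : realType) (P : probability T R) (X : {RV P >-> R}) (beta : R) : Prop :=
  convex_inf_conv_ineq X
    (fun x : R => legendre (cumulant_gen_fun X) (x / beta)%R).

(* Main.v *)
Require Import Defs.
From HB Require Import structures.
From mathcomp Require Import all_boot all_order all_algebra.
From mathcomp Require Import all_classical all_reals all_analysis.
From mathcomp Require Import measurable_realfun ring lra.

Set Implicit Arguments.
Unset Strict Implicit.
Unset Printing Implicit Defensive.

Import Order.TTheory GRing.Theory Num.Theory.
Import numFieldNormedType.Exports.

Local Open Scope classical_set_scope.
Local Open Scope ring_scope.

(* Write phi for the cost, Q f for the infimum convolution of f with phi, N for
   the log-tail, and rescale X so that N(1) is about 1.

   Cost. Lower bounds on the moment generating function show that phi is at most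
   a tiny multiple of (x/100)^2 for |x| <= 100 and at most N(|x|/840)/4 + 1/5
   everywhere.

   Additive form. A product of two nonnegative numbers with sum at most 2 is at
   most 1, so after subtracting a constant from f it suffices to bound
   E[e^(Qf(X)) + e^(-f(X)) - 2] by 0; this is linear in the law of X and can be
   estimated on each side of a base point x1 with f(x1) = 0. For F convex and
   nondecreasing with F = 0 left of z, interpolating between x and x - 100 gives
   pointwise a second-order gain of order (g(x) - g(x - 100))^2, g = min(F, h),
   against a loss of order g(x)^2. Since N is superadditive,
   P(X >= s + 100) <= e^-50 P(X >= s), and a Hardy-type inequality makes the gain
   win; points far beyond the level set F = h are handled by the crude bound
   Qf(x) <= h + phi(x - m), whose exponential moment is exponentially small.

   Base point. If f has a subgradient of size at most p = 1/100 at some x1 in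
   [0, 50] with f decreasing at x1, the gain of order p^2 from X < x1 pays for
   the region X >= x1 where f may be negative. Otherwise f has slope at most
   -1/100 on all of (-oo, 50] (up to reflection), and then
   Qf(x) <= f(z) + phi(x - z) for z = 50 and for z = X' >= 50 is enough. *)

(** * Convex functions on the line *)

(** The weight is a plain real number, so that instances are directly usable in linear and
    polynomial arithmetic; in [convex_function] it lives in an interval type. *)
Definition cvx (R : realType) (f : R -> R) :=
  forall x y t, 0 <= t <= 1 -> f (t * x + (1 - t) * y) <= t * f x + (1 - t) * f y.

Lemma convex_function_cvx (R : realType) (f : R -> R) :
  convex_function [set: R^o] f -> cvx f.
Proof.
move=> cf x y t t01.
have t01' : Itv.spec (@Itv.num_sem R) (Itv.Real `[0%Z, 1%Z]) t.
  by rewrite /= /Itv.num_sem/= in_itv/= num_real/=.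
have := cf (Itv.mk t01') x y; rewrite !inE => /(_ I I).
by [].
Qed.

Section cvx.
Variable R : realType.
Implicit Types (f F : R -> R) (x y z t : R).

Lemma cvx_opp f : cvx f -> cvx (fun x => f (- x)).
Proof.
move=> cf x y t t01; have := cf (- x) (- y) t t01.
by rewrite !mulrN -opprD.
Qed.

(** Clearing the denominator z - x keeps the chord inequality polynomial and lets it hold also for x
    = z. *)
Lemma cvx3 f x y z : cvx f -> x <= y <= z ->
  (z - x) * f y <= (z - y) * f x + (y - x) * f z.
Proof.
move=> cf /andP[xy yz].
have [xz|xz] := eqVneq x z.
  by have -> : y = x; [lra|rewrite -xz; lra].
have zx : 0 < z - x by rewrite subr_gt0 lt_neqAle xz (le_trans xy).
have := cf x z ((z - y) / (z - x)).
have -> : (z - y) / (z - x) * x + (1 - (z - y) / (z - x)) * z = y.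
  by field; rewrite gt_eqF.
move=> /(_ _)/wrap[].
  by rewrite divr_ge0 ?ler_pdivrMr ?mul1r; lra.
rewrite -(ler_pM2l zx) => /le_trans; apply.
by rewrite le_eqVlt; apply/orP; left; apply/eqP; field; rewrite gt_eqF.
Qed.

(** The supremum of the left difference quotients at x serves as s: convexity puts every left
    quotient below every right one. *)
Lemma subgradient f x : cvx f -> exists s, forall y, f x + s * (y - x) <= f y.
Proof.
move=> cf.
pose S := [set (f x - f u) / (x - u) | u in [set u | u < x]].
have key u v : u < x -> x < v -> (f x - f u) / (x - u) <= (f v - f x) / (v - x).
  move=> ux xv; have := @cvx3 f u x v cf; rewrite (ltW ux) (ltW xv) => /(_ isT) h.
  by rewrite ler_pdivrMr ?subr_gt0// mulrAC ler_pdivlMr ?subr_gt0//; nra.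
have ubS v : x < v -> ubound S ((f v - f x) / (v - x)).
  by move=> xv _ [u /= ux <-]; exact: key.
have Sne : S !=set0.
  by exists ((f x - f (x - 1)) / (x - (x - 1))), (x - 1) => //=; lra.
have hS : has_sup S.
  by split => //; exists ((f (x + 1) - f x) / (x + 1 - x)); apply: ubS; lra.
exists (sup S) => y.
have [yx|xy|->] := ltgtP y x; last by rewrite subrr mulr0 addr0.
- have : (f x - f y) / (x - y) <= sup S by apply: ub_le_sup; [exact: hS.2|exists y].
  by rewrite ler_pdivrMr ?subr_gt0//; lra.
- have : sup S <= (f y - f x) / (y - x) by apply: ge_sup => //; exact: ubS.
  by rewrite ler_pdivlMr ?subr_gt0//; lra.
Qed.

(** Near x the function is Lipschitz: a subgradient bounds f y - f x from below, the chords to x - 1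
    and x + 1 bound it from above. *)
Lemma cvx_continuous f : cvx f -> continuous f.
Proof.
move=> cf x; have [s hs] := subgradient x cf.
pose L := `|s| + `|f (x + 1) - f x| + `|f (x - 1) - f x| + 1.
have L0 : 0 < L by rewrite /L ltr_pwDr// !addr_ge0.
have lip y : `|y - x| <= 1 -> `|f y - f x| <= L * `|y - x|.
  move=> yx1; rewrite ler_norml; apply/andP; split.
    have : - (`|s| * `|y - x|) <= s * (y - x).
      by rewrite -normrM lerNl -normrN ler_norm.
    have := hs y; have : `|s| * `|y - x| <= L * `|y - x|.
      by rewrite ler_wpM2r// /L -!addrA lerDl !addr_ge0.
    lra.
  have [yx|xy] := leP y x.
  - have := @cvx3 f (x - 1) y x cf; move: yx1; rewrite ler0_norm ?subr_le0// => yx1.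
    move=> /(_ _)/wrap[]; first by apply/andP; split; lra.
    have := ler_norm (f (x - 1) - f x).
    have : (`|s| + `|f (x + 1) - f x| + 1) * (x - y) >= 0.
      by rewrite mulr_ge0 ?subr_ge0// !addr_ge0.
    rewrite /L; nra.
  - have := @cvx3 f x y (x + 1) cf; move: yx1; rewrite ger0_norm ?subr_ge0 ?(ltW xy)// => yx1.
    move=> /(_ _)/wrap[]; first by apply/andP; split; lra.
    have := ler_norm (f (x + 1) - f x).
    have : (`|s| + `|f (x - 1) - f x| + 1) * (y - x) >= 0.
      by rewrite mulr_ge0 ?subr_ge0 ?(ltW xy)// !addr_ge0.
    rewrite /L; nra.
have near_x (r : R) : 0 < r -> \forall y \near x, `|x - y| <= r.
  by move=> r0; have /cvgrPdist_le := @cvg_id _ (nbhs x); exact.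
apply/cvgrPdist_le => e e0; near=> y.
have y1 : `|y - x| <= 1 by rewrite distrC; near: y; exact: (near_x 1 ltr01).
rewrite distrC (le_trans (lip y y1))// -ler_pdivlMl// distrC; near: y.
by apply: near_x; rewrite mulr_gt0 ?invr_gt0.
Unshelve. all: by end_near. Qed.

(** Both claims come from chords anchored where F vanishes: through z - 1 and z for the sign, from z
    for monotonicity. *)
Lemma cvx_ge0_nd F z : cvx F -> (forall y, y <= z -> F y = 0) ->
  (forall y, 0 <= F y) /\ {homo F : x y / x <= y}.
Proof.
move=> cF F0.
have Fp y : 0 <= F y.
  have [yz|zy] := leP y z; first by rewrite F0.
  have := @cvx3 F (z - 1) z y cF => /(_ _)/wrap[]; first by apply/andP; split; lra.
  rewrite !(F0 (z - 1)) ?(F0 z)//; last lra.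
  by rewrite !mulr0 add0r (_ : z - (z - 1) = 1) ?mul1r//; lra.
split=> // x y xy.
have [xz|zx] := leP x z; first by rewrite F0.
have := @cvx3 F z x y cF; rewrite (ltW zx) xy => /(_ isT).
rewrite (F0 z)// mulr0 add0r => h.
have zy : 0 < y - z by lra.
have : (x - z) * F y <= (y - z) * F y by rewrite ler_wpM2r//; lra.
by move=> h2; rewrite -(ler_pM2l zy); exact: le_trans h h2.
Qed.

(** The cut at z also discards positive values of f on its left, so that the half-line estimate,
    which wants a function vanishing there, can be applied on each side of a zero of f. *)
Definition rpart f z x := if z < x then Num.max (f x) 0 else 0.

Lemma rpart_cvx f z : cvx f -> f z = 0 -> cvx (rpart f z).
Proof.
move=> cf fz.
have rp0 x : 0 <= rpart f z x by rewrite /rpart; case: ifP => // _; rewrite le_max lexx orbT.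
have rpf x : z <= x -> f x <= rpart f z x.
  rewrite le_eqVlt => /orP[/eqP <-|zx]; first by rewrite fz.
  by rewrite /rpart zx le_max lexx.
have H x y t : 0 <= t <= 1 -> x <= y ->
    rpart f z (t * x + (1 - t) * y) <= t * rpart f z x + (1 - t) * rpart f z y.
  move=> /andP[t0 t1] xy.
  have R0 : 0 <= t * rpart f z x + (1 - t) * rpart f z y.
    by rewrite addr_ge0// mulr_ge0// subr_ge0.
  set w := t * x + _; rewrite {1}/rpart; case: ifPn => // zw.
  rewrite ge_max R0 andbT.
  have xw : x <= w by rewrite /w; nra.
  have wy : w <= y by rewrite /w; nra.
  have [zx|xz] := leP z x.
    have := cf x y t; rewrite t0 t1 => /(_ isT).
    have := rpf _ zx; have := rpf _ (le_trans zx xy).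
    by rewrite -/w; nra.
  (* Here x < z: the chord starts from (z, 0), and w - z <= (1 - t)(y - z) because t (x - z) <=
     0. *)
  have := @cvx3 f z w y cf; rewrite (ltW zw) wy => /(_ isT); rewrite fz mulr0 add0r => h.
  have zy : 0 < y - z by lra.
  have h2 : f w <= (1 - t) * rpart f z y.
    rewrite -(ler_pM2l zy) (le_trans h)//.
    have := rpf y; have := rp0 y => r0 /(_ _)/wrap[]; first lra.
    move=> r1; apply: (@le_trans _ _ ((w - z) * rpart f z y)); first by rewrite ler_wpM2l//; lra.
    by rewrite mulrA ler_wpM2r// /w; nra.
  by have := rp0 x; nra.
move=> x y t t01; have [xy|yx] := leP x y; first exact: H.
have := @H y x (1 - t); rewrite (ltW yx) => /(_ _ isT)/wrap[].
  by move/andP: t01 => [? ?]; apply/andP; split; lra.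
by rewrite (_ : 1 - (1 - t) = t); [rewrite addrC [X in _ <= X -> _]addrC|lra].
Qed.

Lemma cvx_measurable_comp d (T : measurableType d) f (X : T -> R) :
  cvx f -> measurable_fun setT X -> measurable_fun setT (f \o X).
Proof.
move=> cf mX; apply: measurableT_comp => //.
by apply: continuous_measurable_fun; exact: cvx_continuous.
Qed.

End cvx.

(** * Probability estimates from tails *)

Lemma upset_measurable (R : realType) (S : set R) :
  (forall x y, S x -> x <= y -> S y) -> measurable S.
Proof.
move=> uS; apply: is_interval_measurable => x y Sx _ z /andP[xz _].
exact: uS xz.
Qed.

Lemma nd_measurable (R : realType) (G : R -> \bar R) :
  {homo G : x y / x <= y >-> (x <= y)%E} -> measurable_fun setT G.
Proof.
move=> ndG _; apply: (measurability _ (ErealGenOInfty.measurableE R)) => //.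
move=> _ [_ [r ->] <-]; rewrite setTI; apply: upset_measurable => x y /=.
by rewrite !in_itv/= !andbT => rx xy; exact: lt_le_trans rx (ndG _ _ xy).
Qed.

Section prob.
Context d (T : measurableType d) (R : realType) (P : probability T R).
Local Open Scope ereal_scope.

Lemma preimage_measurable (X : T -> R) (S : set R) :
  measurable_fun setT X -> measurable S -> measurable (X @^-1` S).
Proof. by move=> mX mS; rewrite -[_ @^-1` _]setTI; exact: mX. Qed.

Lemma prob_integral_cst (D : set T) (r : \bar R) :
  measurable D -> \int[P]_(w in D) r = r * P D.
Proof. by move=> mD; exact: (integral_cst P mD). Qed.

Lemma prob_setT : P setT = 1. Proof. exact: probability_setT. Qed.

Lemma measurable_ge (X : T -> R) t :
  measurable_fun setT X -> measurable [set w | (t <= X w)%R].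
Proof.
move=> mX; apply: (@preimage_measurable X [set x | (t <= x)%R]) => //.
by apply: upset_measurable => x y /=; exact: le_trans.
Qed.

Lemma measurable_gt (X : T -> R) t :
  measurable_fun setT X -> measurable [set w | (t < X w)%R].
Proof.
move=> mX; apply: (@preimage_measurable X [set x | (t < x)%R]) => //.
by apply: upset_measurable => x y /=; exact: lt_le_trans.
Qed.

Lemma measurable_lt (X : T -> R) t :
  measurable_fun setT X -> measurable [set w | (X w < t)%R].
Proof.
move=> mX; rewrite (_ : [set _ | _] = ~` [set w | (t <= X w)%R]).
  by apply: measurableC; exact: measurable_ge.
by apply/seteqP; split => w /=; rewrite ltNge => /negP.
Qed.

Lemma prob_abs_ge (X : T -> R) s : measurable_fun setT X -> (0 < s)%R ->
  P [set w | (s <= X w)%R] = P [set w | (s <= - X w)%R] ->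
  P [set w | (s <= `|X w|)%R] = P [set w | (s <= X w)%R] + P [set w | (s <= X w)%R].
Proof.
move=> mX s0 symX; rewrite [in X in _ = _ + X]symX -measureU//.
- congr (P _); apply/seteqP; split => w /=; first by rewrite ler_normr => /orP.
  by rewrite ler_normr => -[->|->]//; rewrite orbT.
- exact: measurable_ge.
- by apply: measurable_ge; exact: measurable_funN.
- by apply/seteqP; split => w //= -[]; lra.
Qed.

(** Passes from closed rays to all up-sets: a nonempty up-set is an increasing union of rays [u n,
    oo) with u n in S, and P is continuous from below. *)
Lemma prob_upset (X : T -> R) (S : set R) (c : \bar R) :
  measurable_fun setT X -> (forall x y, S x -> (x <= y)%R -> S y) -> 0 <= c ->
  (forall t, S t -> P [set w | (t <= X w)%R] <= c) -> P (X @^-1` S) <= c.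
Proof.
move=> mX uS c0 Sc.
have mS := upset_measurable uS.
have seq_case (u : R^nat) : (forall n, S (u n)) -> nonincreasing_seq u ->
    (forall x, S x -> exists n, (u n <= x)%R) -> P (X @^-1` S) <= c.
  move=> Su niu uc; pose F n := [set w | (u n <= X w)%R].
  have FE : X @^-1` S = \bigcup_n F n.
    apply/seteqP; split => w /=; first by move=> /uc[n ?]; exists n.
    by move=> [n _ /=]; exact: uS (Su n).
  have : P \o F @ \oo --> P (\bigcup_n F n).
    apply: nondecreasing_cvg_mu.
    - by move=> n; exact: measurable_ge.
    - by rewrite -FE; exact: preimage_measurable.
    - by move=> m n mn; apply/subsetPset => w /=; apply: le_trans; exact: niu.
  by rewrite -FE; apply: cvge_le; apply: nearW => n; exact: Sc.
have [->|/set0P[x0 Sx0]] := eqVneq S set0; first by rewrite preimage_set0 measure0.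
(* The sequence u is -n if S is unbounded below, the constant inf S if the infimum is attained, and
   inf S + 1/(n+1) otherwise. *)
have [lbS|nlbS] := pselect (has_lbound S); last first.
  apply: (seq_case (fun n => - n%:R)%R).
  - move=> n; have [//|nS] := pselect (S (- n%:R)%R); exfalso; apply: nlbS.
    exists (- n%:R)%R => x Sx; rewrite leNgt; apply/negP => xn; apply: nS.
    exact: uS (ltW xn).
  - by move=> m n mn; rewrite lerN2 ler_nat.
  - move=> x _; exists (Num.truncn `|x|).+1.
    by have := truncnS_gt `|x|%R; have := lerNnormlW (lexx `|x|%R); lra.
have iS : has_inf S by split => //; exists x0.
have [Si|nSi] := pselect (S (inf S)).
  apply: (seq_case (fun=> inf S)) => // x Sx; exists 0%N.
  exact: ge_inf.
have lt_inf x : S x -> (inf S < x)%R.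
  move=> Sx; rewrite lt_neqAle ge_inf// andbT.
  by apply/eqP => E; apply: nSi; rewrite E.
apply: (seq_case (fun n => inf S + n.+1%:R^-1)%R).
- move=> n; have n0 : (0 < n.+1%:R^-1 :> R)%R by rewrite invr_gt0.
  by have [e Se /ltW] := inf_adherent n0 iS; exact: uS.
- by move=> m n mn; rewrite lerD2l lef_pV2 ?posrE// ler_nat.
- move=> x /lt_inf ix; have xi0 : (0 < x - inf S)%R by lra.
  exists (Num.truncn (x - inf S)^-1%R); rewrite -lerBrDl.
  by rewrite -[leRHS]invrK lef_pV2 ?posrE ?invr_gt0// ltW// truncnS_gt.
Qed.

(** Layer-cake formula: the expectation of a nonnegative variable is the integral of its tail over r
    >= 0, so the hypothesis can be integrated in r. *)
Lemma tail_comparison (U V : T -> R) (rho : R) :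
  measurable_fun setT U -> measurable_fun setT V ->
  (forall w, 0 <= U w)%R -> (forall w, 0 <= V w)%R -> (0 <= rho)%R ->
  (forall r, (0 <= r)%R ->
    P [set w | (r < U w)%R] <= rho%:E * P [set w | (r < V w)%R]) ->
  \int[P]_w (U w)%:E <= rho%:E * \int[P]_w (V w)%:E.
Proof.
move=> mU mV U0 V0 rho0 UV.
pose U' : {RV P >-> R} := HB.pack U (@isMeasurableFun.Build _ _ _ _ U mU).
pose V' : {RV P >-> R} := HB.pack V (@isMeasurableFun.Build _ _ _ _ V mV).
have := @ge0_expectation_ccdf _ _ _ P U' U0.
have := @ge0_expectation_ccdf _ _ _ P V' V0.
rewrite unlock => -> ->.
rewrite -ge0_integralZl//; last first.
  by apply: measurable_funTS; exact: ccdf_measurable.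
apply: ge0_le_integral => //.
- by apply: measurable_funTS; exact: ccdf_measurable.
- by apply: measurable_funeM; apply: measurable_funTS; exact: ccdf_measurable.
move=> r /=; rewrite in_itv/= andbT => r0.
have ccdfE (W : {RV P >-> R}) : ccdf W r = P [set w | (r < W w)%R].
  rewrite /ccdf /distribution /pushforward; congr (P _).
  by apply/seteqP; split => w /=; rewrite in_itv/= andbT.
by rewrite !ccdfE; exact: UV.
Qed.

(** Truncate U at 2^k. Raising the level to 2^(k+1) costs at most 2^k P(U > 2^k) <= c / 2^k; these
    costs sum to 2c on top of the initial c, and monotone convergence removes the truncation. *)
Lemma integral_le_of_dyadic_tail (U : T -> \bar R) (c : R) :
  measurable_fun setT U -> (forall w, 0 <= U w) -> (0 <= c)%R ->
  P [set w | 0 < U w] <= c%:E ->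
  (forall k, P [set w | (2 ^+ k)%:E < U w] <= (c / 4 ^+ k)%:E) ->
  \int[P]_w U w <= (3 * c)%:E.
Proof.
move=> mU U0 c0 P0 Pk.
pose V (k : nat) (w : T) : \bar R := mine (U w) (2 ^+ k)%:E.
have mV k : measurable_fun setT (V k) by apply: measurable_mine.
have V0 k w : 0 <= V k w by rewrite le_min U0 lee_fin exprn_ge0.
have mS (r : R) : measurable [set w | r%:E < U w].
  by rewrite -[[set w | _]]setTI; exact: emeasurable_fun_o_infty.
have IV k : \int[P]_w V k w <= (c * (3 - 2 / 2 ^+ k))%:E.
  elim: k => [|k IH].
    rewrite expr0 divr1 (_ : 3 - 2 = 1)%R ?mulr1; last by lra.
    apply: le_trans P0; have <- : \int[P]_w (\1_[set w | 0 < U w]%E w)%:E = P [set w | 0 < U w].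
      by rewrite integral_indic ?setIT//; exact: (mS 0%R).
    apply: ge0_le_integral => //.
    + by apply/measurable_EFinP; apply/measurable_indicP; exact: (mS 0%R).
    move=> w _; rewrite /V expr0 indicE.
    have := U0 w; rewrite le_eqVlt => /orP[/eqP <-|Uw].
      by rewrite min_l ?lee01 ?lee_fin// ler0n.
    by rewrite mem_set//= ge_min lexx orbT.
  pose I (w : T) : \bar R := (\1_[set w | (2 ^+ k)%:E < U w]%E w)%:E.
  have I0 w : 0 <= I w by rewrite lee_fin.
  have m1 : measurable_fun setT I.
    by apply/measurable_EFinP; exact/measurable_indicP.
  have m2 : measurable_fun setT (fun w => (2 ^+ k)%:E * I w) by exact: measurable_funeM.
  apply: (@le_trans _ _ (\int[P]_w (V k w + (2 ^+ k)%:E * I w))).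
    apply: ge0_le_integral => //.
    + by apply: emeasurable_funD => //.
    move=> w _; rewrite /I indicE /V.
    have [Uw|Uw] := leP (U w) (2 ^+ k)%:E.
      rewrite memNset/= ?mule0 ?adde0; last by rewrite ltNge Uw.
      by rewrite ge_min lexx.
    rewrite mem_set// mule1 -EFinD exprS ge_min; apply/orP; right.
    by rewrite lee_fin; lra.
  rewrite ge0_integralD//; last first.
    by move=> w _; rewrite mule_ge0// lee_fin// exprn_ge0.
  rewrite ge0_integralZl//.
  rewrite integral_indic// setIT.
  apply: (@le_trans _ _ ((c * (3 - 2 / 2 ^+ k))%:E + (2 ^+ k)%:E * (c / 4 ^+ k)%:E)).
    apply: leeD => //; apply: lee_wpmul2l; first by rewrite lee_fin exprn_ge0.
    exact: Pk.
  rewrite -EFinM -EFinD lee_fin (_ : 4 ^+ k = 2 ^+ k * 2 ^+ k)%R; last first.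
    by rewrite -exprMn; congr (_ ^+ _)%R; lra.
  have p2 : (2 ^+ k != 0 :> R)%R by rewrite expf_neq0.
  rewrite exprS le_eqVlt; apply/orP; left; apply/eqP; field.
  by rewrite p2.
have limV w : limn (V^~ w) = U w.
  apply/cvg_lim => //; rewrite /V.
  have pow2 (r : R) : \forall k \near \oo, (r <= 2 ^+ k)%R.
    near=> k; apply: (@le_trans _ _ k%:R); last first.
      by rewrite -natrX ler_nat ltnW// ltn_expl.
    by near: k; exact: nbhs_infty_ger.
  have := U0 w; case: (U w) => [r _| _|//].
  - apply: cvg_near_cst; have := pow2 r; apply: filterS => k rk.
    by apply/min_idPl; rewrite lee_fin.
  - under eq_fun do rewrite min_r ?leey//.
    apply/cvgeyPge => r; have := pow2 r; apply: filterS => k.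
    by rewrite lee_fin.
under eq_integral do rewrite -limV.
rewrite monotone_convergence//; last first.
  move=> w _ m n mn; rewrite /V le_min ge_min lexx/= ge_min; apply/orP; right.
  by rewrite lee_fin ler_weXn2l// ler1n.
apply: lime_le.
  apply: ereal_nondecreasing_is_cvgn => m n mn; apply: ge0_le_integral => //.
  move=> w _; rewrite /V le_min ge_min lexx/= ge_min; apply/orP; right.
  by rewrite lee_fin ler_weXn2l// ler1n.
apply: nearW => k; apply: (le_trans (IV k)); rewrite lee_fin mulrC ler_wpM2r//.
by rewrite lerBlDr lerDl divr_ge0// exprn_ge0.
Unshelve. all: by end_near. Qed.

End prob.

(** * Elementary bounds on the exponential *)

Section exp_bounds.
Variable R : realType.
Implicit Types x y q s r : R.

Lemma expR_le_inv x : x < 1 -> expR x <= (1 - x)^-1.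
Proof.
move=> x1; rewrite -[x in expR x]opprK expRN lef_pV2 ?posrE ?expR_gt0 ?subr_gt0//.
exact: expR_ge1Dx.
Qed.

Lemma expR_le_quad x : 0 <= x <= 1/50 -> expR x <= 1 + x + 21/20 * x ^+ 2.
Proof.
move=> /andP[x0 x1]; apply: (le_trans (expR_le_inv _)); first lra.
by rewrite -[leLHS]mul1r ler_pdivrMr; [nra|lra].
Qed.

Lemma expRN_le_quad x : 0 <= x -> expR (- x) <= 1 - x + x ^+ 2.
Proof.
move=> x0; apply: (le_trans (expR_le_inv _)); first lra.
by rewrite -[leLHS]mul1r ler_pdivrMr; [nra|lra].
Qed.

(** The tangent line at t x, evaluated at 0 and at x, averaged with weights 1 - t and t. *)
Lemma expR_le_chord t x : 0 <= t <= 1 -> expR (t * x) <= 1 - t + t * expR x.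
Proof.
move=> /andP[t0 t1].
have tangent z : expR (t * x) * (1 + (z - t * x)) <= expR z.
  have -> : expR z = expR (t * x) * expR (z - t * x) by rewrite -expRD; congr expR; lra.
  by rewrite ler_wpM2l ?expR_ge0// expR_ge1Dx.
have := tangent x; have := tangent 0; rewrite expR0 => h0 hx.
have : (1 - t) * (expR (t * x) * (1 + (0 - t * x))) <= (1 - t) * 1 by rewrite ler_wpM2l ?subr_ge0.
have : t * (expR (t * x) * (1 + (x - t * x))) <= t * expR x by rewrite ler_wpM2l.
lra.
Qed.

Lemma expR1_ge : 5/2 <= expR 1 :> R.
Proof.
have -> : (1 : R) = 10%:R * (1/10) by lra.
rewrite expRM_natl; apply: (@le_trans _ _ ((1 + 1/10) ^+ 10)); first by lra.
by rewrite lerXn2r ?nnegrE ?expR_ge0 ?expR_ge1Dx//; lra.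
Qed.

Lemma expR1_le : expR 1 <= 3 :> R.
Proof.
have -> : (1 : R) = 10%:R * (1/10) by lra.
rewrite expRM_natl; apply: (@le_trans _ _ ((10 / 9) ^+ 10)); last by lra.
rewrite lerXn2r ?nnegrE ?expR_ge0//.
apply: (le_trans (expR_le_inv _)); first by lra.
by rewrite (_ : 1 - 1/10 = (10/9)^-1) ?invrK//; field.
Qed.

Lemma expRN_le_pow n : expR (- n%:R) <= (1/2) ^+ n :> R.
Proof.
rewrite -[n%:R]mulr1 -mulrN expRM_natl lerXn2r ?nnegrE ?expR_ge0//.
rewrite expRN (_ : 1/2 = 2^-1); last by lra.
by rewrite lef_pV2 ?posrE ?expR_gt0//; have := expR1_ge; lra.
Qed.

(** The excess over 2 is e^(-a) (e^a - 1)^2, and e^a - 1 <= a e^a. *)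
Lemma expR_sym_le (a : R) : 0 <= a -> expR (- a) + expR a <= 2 + a ^+ 2 * expR a.
Proof.
move=> a0; have e0 := expR_gt0 (- a).
have E : expR (- a) * expR a = 1 by rewrite -expRD addNr expR0.
have h : 1 - a <= expR (- a) by have := expR_ge1Dx (- a); lra.
have e1 : expR (- a) <= 1 by rewrite -expR0 ler_expR oppr_le0.
have h2 : expR a - 1 <= a * expR a.
  have : (1 - a) * expR a <= expR (- a) * expR a by rewrite ler_wpM2r ?expR_ge0.
  by rewrite E; lra.
have h0 : 0 <= expR a - 1 by have := expR_ge1Dx a; lra.
have : (expR a - 1) ^+ 2 <= (a * expR a) ^+ 2.
  by rewrite lerXn2r ?nnegrE// mulr_ge0// expR_ge0.
rewrite exprMn => h3.
have : expR (- a) * (expR a - 1) ^+ 2 <= expR (- a) * (a ^+ 2 * expR a ^+ 2).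
  by rewrite ler_wpM2l// ltW.
rewrite (_ : expR (- a) * (a ^+ 2 * expR a ^+ 2) = (expR (- a) * expR a) * (a ^+ 2 * expR a)); last by ring.
rewrite (_ : expR (- a) * (expR a - 1) ^+ 2 = (expR (- a) * expR a) * expR a - 2 * (expR (- a) * expR a) + expR (- a)); last by ring.
by rewrite E !mul1r; lra.
Qed.

(** Squaring c x <= e^(c x - 1) with 2c = 1/2 - 1/100 gives x^2 <= (e^-2 / c^2) e^(49x/100), and
    16/100 over 6/100 is below 27/10. *)
Lemma sqr_expR_le x : 0 <= x -> x ^+ 2 * expR (x / 100) <= 27/10 * expR (x / 2).
Proof.
move=> x0; pose c : R := 49/200.
have h : (c * x) ^+ 2 <= expR (c * x - 1) ^+ 2.
  have := expR_ge1Dx (c * x - 1); rewrite addrCA subrr addr0 => h.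
  by rewrite lerXn2r ?nnegrE ?expR_ge0// mulr_ge0// /c; lra.
have e2 : expR (c * x - 1) ^+ 2 = expR (49/100 * x) * expR (-1) ^+ 2.
  by rewrite -!expRM_natl -expRD; congr expR; rewrite /c; lra.
have e1 : expR (-1) <= 4/10 :> R.
  rewrite expRN (_ : 4/10 = (5/2)^-1); last by field.
  by rewrite lef_pV2 ?posrE ?expR_gt0//; exact: expR1_ge.
have e12 : expR (-1) ^+ 2 <= 16/100 :> R.
  apply: (@le_trans _ _ ((4/10) ^+ 2)); last by lra.
  by rewrite lerXn2r ?nnegrE ?expR_ge0//; lra.
have e3 : expR (x / 2) = expR (49/100 * x) * expR (x / 100).
  by rewrite -expRD; congr expR; lra.
rewrite e3 mulrA ler_wpM2r ?expR_ge0//.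
move: h; rewrite e2 exprMn => h.
have h2 : expR (49/100 * x) * expR (-1) ^+ 2 <= expR (49/100 * x) * (16/100).
  by rewrite ler_wpM2l ?expR_ge0.
have := expR_ge0 (49/100 * x).
have c2 : 6/100 <= c ^+ 2 by rewrite /c; lra.
have : 6/100 * x ^+ 2 <= c ^+ 2 * x ^+ 2 by rewrite ler_wpM2r ?sqr_ge0.
lra.
Qed.

(* With [s = F x] and [r = F (x - 100)], the hypothesis on [q] is what convexity
   gives at the point [x - 100 l]; the gain is [82 (g - r)^2] for [g] the
   truncation of [s], and [(g - r)^2 >= 9/10 g^2 - 9 r^2]. *)
Lemma interpolation_gain q s r : 0 <= r <= 1/100 -> r <= s ->
  (forall l, 0 <= l <= 1 -> q <= s - l * (s - r) + l ^+ 2 / 560) ->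
  expR q + expR (- s) + 68 * Num.min s (1/100) ^+ 2 <= 2 + 726 * r ^+ 2.
Proof.
move=> /andP[r0 r1] rs Hq.
pose g := Num.min s (1/100); pose v := g - r.
have gs : g <= s by rewrite /g ge_min lexx.
have gh : g <= 1/100 by rewrite /g ge_min lexx orbT.
have rg : r <= g by rewrite /g le_min rs r1.
have v0 : 0 <= v by rewrite /v; lra.
have v1 : v <= 1/100 by rewrite /v; lra.
have q1 : q <= r + 1/560.
  by have := Hq 1; rewrite lexx ler01 => /(_ isT); lra.
have q2 : q <= s - 82 * v ^+ 2.
  (* The minimum of -l v + l^2/560 is at l = 280 v when this is at most 1. Otherwise l = 1 is used:
     v - 1/560 >= 82 v^2 between 1/280 and 1/100. *)
  have [vs|vl] := leP v (1/280).
    have := Hq (280 * v) => /(_ _)/wrap[]; first by apply/andP; split; lra.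
    have : v * (s - r) >= v * v by rewrite ler_wpM2l//; rewrite /v; lra.
    by nra.
  have : (v - 1/280) * (1/100 - v) >= 0 by rewrite mulr_ge0; lra.
  have : v <= s - r by rewrite /v; lra.
  have := Hq 1; rewrite lexx ler01 => /(_ isT).
  by nra.
(* Q bounds q while s >= Q + 82 v^2, so the first-order terms of e^Q and e^(-s) cancel up to -82
   v^2, and all that remains is quadratic in Q and v. *)
pose Q := Num.min (r + 1/560) (s - 82 * v ^+ 2).
have Qr : Q <= r + 1/560 by rewrite /Q ge_min lexx.
have Qs : Q <= s - 82 * v ^+ 2 by rewrite /Q ge_min lexx orbT.
have qQ : q <= Q by rewrite /Q le_min q1 q2.
have vs : v <= s by rewrite /v; lra.
have v2 : v ^+ 2 <= 1/100 * v by rewrite expr2 ler_wpM2r.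
have v20 : 0 <= v ^+ 2 by rewrite sqr_ge0.
have Q0 : 0 <= Q by rewrite /Q le_min; apply/andP; split; lra.
have Qg : Q ^+ 2 <= 14/10 * g ^+ 2.
  have [sh|hs] := leP s (1/100).
    have gE : g = s by rewrite /g min_l.
    have : Q <= g by rewrite gE; lra.
    by nra.
  have gE : g = 1/100 by rewrite /g min_r// ltW.
  have : Q <= 1/100 + 1/560 by lra.
  by rewrite gE; nra.
have tau0 : 0 <= Q + 82 * v ^+ 2 by lra.
have e1 : expR q <= 1 + Q + 21/20 * Q ^+ 2.
  apply: (@le_trans _ _ (expR Q)); first by rewrite ler_expR.
  by apply: expR_le_quad; apply/andP; split; lra.
have e2 : expR (- s) <= 1 - (Q + 82 * v ^+ 2) + (Q + 82 * v ^+ 2) ^+ 2.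
  apply: le_trans (expRN_le_quad tau0).
  by rewrite ler_expR; lra.
have e3 : (Q + 82 * v ^+ 2) ^+ 2 <= 2 * Q ^+ 2 + 136/100 * v ^+ 2.
  have : v ^+ 2 * v ^+ 2 <= 1/10000 * v ^+ 2.
    by rewrite ler_wpM2r//; nra.
  have : 0 <= (Q - 82 * v ^+ 2) ^+ 2 by rewrite sqr_ge0.
  by nra.
have e4 : v ^+ 2 >= 9/10 * g ^+ 2 - 9 * r ^+ 2.
  have : 0 <= (g - 10 * r) ^+ 2 by rewrite sqr_ge0.
  by rewrite /v; nra.
(* The sum is at most 2 + 3.05 Q^2 - 80.64 v^2; with Q^2 <= 1.4 g^2 the coefficient of g^2 is below
   -68 and that of r^2 below 726. *)
rewrite -/g; have r20 : 0 <= r ^+ 2 by rewrite sqr_ge0.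
have g20 : 0 <= g ^+ 2 by rewrite sqr_ge0.
by lra.
Qed.

End exp_bounds.

(** * The rescaled variable and its cost *)

(* For the rescaled variable with [beta = 3360]: [100] is the range of
   interpolation, [840 = 3360 / 4], and [1/5] dominates [(ln 2) / 4]. *)
Record normalized_cost d (T : measurableType d) (R : realType) (P : probability T R)
    (X : {RV P >-> R}) (phi : R -> \bar R) : Prop := NormalizedCost {
  nc_sym : forall t : R, P [set w | t <= X w] = P [set w | t <= - X w];
  nc_mul : forall s t : R, 0 <= s -> 0 <= t ->
    (P [set w | (s + t <= `|X w|)%R] <=
     P [set w | (s <= `|X w|)%R] * P [set w | (t <= `|X w|)%R])%E;
  nc_one : ((3^-1 : R)%:E <= P [set w | (1 <= `|X w|)%R])%E;
  nc_lin : forall t, 1 < t -> (t%:E <= log_tail (P := P) X t)%E;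
  nc_scale : forall c t, 0 <= c <= 1 -> 0 <= t ->
    (log_tail (P := P) X (c * t)%R <= c%:E * log_tail (P := P) X t)%E;
  nc_ge0 : forall x, (0 <= phi x)%E;
  nc_even : forall x, phi (- x) = phi x;
  nc_convex : econvex_function setT phi;
  nc_quad : forall x, `|x| <= 100 -> (phi x <= ((x / 100) ^+ 2 / 560)%:E)%E;
  nc_tail : forall x,
    (phi x <= (1/4)%:E * log_tail (P := P) X (`|x| / 840)%R + (1/5)%:E)%E }.

Arguments normalized_cost {d T R} P X phi.

(** * Exponential moments of the log-tail *)

Section tail.
Context d (T : measurableType d) (R : realType) (P : probability T R).
Variable X : {RV P >-> R}.
Local Open Scope ereal_scope.

Let mX : measurable_fun setT (X : T -> R). Proof. exact: measurable_funPT. Qed.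

Let mabsX : measurable_fun setT (fun w => `|X w|%R).
Proof. exact: measurableT_comp. Qed.

Lemma tail_log_tail t : P [set w | (t <= `|X w|)%R] = expeR (- log_tail (P := P) X t).
Proof. by rewrite /log_tail oppeK lneK// in_itv/= measure_ge0 leey. Qed.

Lemma log_tail_ge0 t : 0 <= log_tail (P := P) X t.
Proof. by rewrite /log_tail oppe_ge0 lne_le0 probability_le1//; exact: measurable_ge. Qed.

Lemma log_tail_nd s t : (s <= t)%R -> log_tail (P := P) X s <= log_tail (P := P) X t.
Proof.
move=> st; rewrite /log_tail leeN2 -lee_expeR !lneK ?in_itv/= ?measure_ge0 ?leey//.
apply: le_measure; rewrite ?inE; [exact: measurable_ge|exact: measurable_ge|].
by move=> w /=; exact: le_trans.
Qed.

Definition tail_moment (c : R) (w : T) : \bar R := expeR (c%:E * log_tail (P := P) X `|X w|%R).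

Lemma tail_moment_measurable c : (0 <= c)%R -> measurable_fun setT (tail_moment c).
Proof.
move=> c0; apply: (@measurableT_comp _ _ _ _ _ _ (fun t => expeR (c%:E * log_tail (P := P) X t))) => //.
apply: nd_measurable => s t st; rewrite lee_expeR.
by apply: lee_wpmul2l; [rewrite lee_fin|exact: log_tail_nd].
Qed.

Lemma tail_moment_ge1 c w : (0 <= c)%R -> 1 <= tail_moment c w.
Proof.
move=> c0; rewrite -expeR0 lee_expeR mule_ge0// ?lee_fin//.
exact: log_tail_ge0.
Qed.

Lemma tail_le_pow (t : R) k :
  (2 ^+ k)%:E < expeR ((1/2)%:E * log_tail (P := P) X t) ->
  P [set w | (t <= `|X w|)%R] <= ((4 ^+ k)^-1)%:E.
Proof.
rewrite tail_log_tail; case: (log_tail (P := P) X t) (log_tail_ge0 t) => [r| |]// r0.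
- rewrite -EFinM/= !lte_fin lee_fin => kr.
  rewrite expRN lef_pV2 ?posrE ?expR_gt0 ?exprn_gt0//.
  have -> : r = (1/2 * r + 1/2 * r)%R by lra.
  rewrite expRD (_ : 4 ^+ k = 2 ^+ k * 2 ^+ k)%R; last first.
    by rewrite -exprMn; congr (_ ^+ _)%R; lra.
  by rewrite ler_pM ?exprn_ge0 ?ltW.
- by move=> _ /=; rewrite lee_fin invr_ge0 exprn_ge0.
Qed.

(** N(|X|) is dominated in law by a standard exponential variable: e^(N/2) exceeds 2^k with
    probability at most 4^-k, so the dyadic bound applies with c = 1. *)
Lemma tail_moment_half_le : \int[P]_w tail_moment (1/2) w <= 3%:E.
Proof.
rewrite (_ : 3%:E = (3 * 1)%:E); last by rewrite mulr1.
have h0 : (0 <= 1/2 :> R)%R by lra.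
have m0 w : 0 <= tail_moment (1/2) w by rewrite (le_trans _ (tail_moment_ge1 w h0))// lee01.
apply: integral_le_of_dyadic_tail => //; first exact: tail_moment_measurable.
  apply: probability_le1; rewrite -[[set w | _]]setTI; apply: emeasurable_fun_o_infty => //.
  exact: tail_moment_measurable.
move=> k; apply: (@prob_upset _ _ _ _ (fun w => `|X w|%R)
    [set t | (2 ^+ k)%:E < expeR ((1/2)%:E * log_tail (P := P) X t)]) => //=.
- move=> x y kx xy; apply: (lt_le_trans kx); rewrite lee_expeR.
  by apply: lee_wpmul2l; [rewrite lee_fin; lra|exact: log_tail_nd].
- by move=> t /tail_le_pow; rewrite mul1r.
Qed.

(** Since c N is the average of 0 and N/2 with weights 1 - 2c and 2c, convexity of exp gives 1 - 2c
    + 2c * 3. *)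
Lemma tail_moment_le c : (0 <= c <= 1/2)%R ->
  \int[P]_w tail_moment c w <= (1 + 4 * c)%:E.
Proof.
move=> /andP[c0 c1]; have h0 : (0 <= 1/2 :> R)%R by lra.
have mh := tail_moment_measurable h0.
have m0 w : 0 <= tail_moment (1/2) w by rewrite (le_trans _ (tail_moment_ge1 w h0))// lee01.
apply: (@le_trans _ _ (\int[P]_w ((1 - 2 * c)%:E + (2 * c)%:E * tail_moment (1/2) w))).
  apply: ge0_le_integral => //.
  - by move=> w _; rewrite (le_trans _ (tail_moment_ge1 w c0))// lee01.
  - exact: tail_moment_measurable.
  - by apply: emeasurable_funD => //; exact: measurable_funeM.
  move=> w _; rewrite /tail_moment; case: (log_tail (P := P) X _) (log_tail_ge0 `|X w|%R) => [r| |]// r0.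
    rewrite -!EFinM/= -?EFinM -?EFinD lee_fin.
    have := @expR_le_chord R (2 * c)%R (1/2 * r)%R; rewrite (_ : 2 * c * (1 / 2 * r) = c * r)%R; last by lra.
    by apply; apply/andP; split; lra.
  (* N may be infinite here; c = 0 is separate because 0 * +oo = 0. *)
  have [->|cn0] := eqVneq c 0%R; first by rewrite mul0e expeR0 mulr0 mul0e adde0 subr0.
  rewrite [(1/2)%:E * _]gt0_muley ?lte_fin; last by lra.
  have c20 : 0 < (2 * c)%:E by rewrite lte_fin mulr_gt0// lt_neqAle eq_sym cn0.
  by rewrite /= (gt0_muley c20) addey// leey.
rewrite ge0_integralD//; last 3 first.
- by move=> w _; rewrite lee_fin; lra.
- by move=> w _; rewrite mule_ge0// lee_fin; lra.
- exact: measurable_funeM.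
rewrite ge0_integralZl//; last by rewrite lee_fin; lra.
rewrite prob_integral_cst// prob_setT mule1.
apply: (@le_trans _ _ ((1 - 2 * c)%:E + (2 * c)%:E * 3%:E)).
  apply: leeD => //; apply: lee_wpmul2l; first by rewrite lee_fin; lra.
  exact: tail_moment_half_le.
by rewrite -EFinM -EFinD lee_fin; lra.
Qed.

(** For |X| > 1 the exponent |X|/2 is at most N(|X|)/2; for |X| <= 1 no linear bound on N is
    available, but e^(1/2) <= 2. *)
Lemma expR_abs_le (w : T) : (forall t, (1 < t)%R -> t%:E <= log_tail (P := P) X t) ->
  (expR (`|X w| / 2))%:E <= 1 + tail_moment (1/2) w.
Proof.
move=> lin; have h0 : (0 <= 1/2 :> R)%R by lra.
have m1 := tail_moment_ge1 w h0.
have [w1|w1] := leP `|X w|%R 1%R.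
  apply: (@le_trans _ _ (1 + 1)); last exact: leeD.
  rewrite -EFinD lee_fin; apply: (@le_trans _ _ (expR (1/2))).
    by rewrite ler_expR; lra.
  apply: (le_trans (expR_le_inv _)); first by lra.
  by rewrite (_ : 1 - 1/2 = 2^-1)%R ?invrK//; field.
apply: (@le_trans _ _ (tail_moment (1/2) w)); last by rewrite leeDr.
rewrite /tail_moment; have := lin _ w1.
case: (log_tail (P := P) X _) => [n| |]//; last first.
  by move=> _; rewrite gt0_muley ?leey// lte_fin; lra.
by rewrite -EFinM lee_fin /= lee_fin ler_expR; lra.
Qed.

End tail.
Arguments tail_moment {d T R} P X c w.

(** * Decay of tails and moments under a shift *)

Section shift.
Context d (T : measurableType d) (R : realType) (P : probability T R).
Variables (X : {RV P >-> R}) (phi : R -> \bar R).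
Hypothesis nc : normalized_cost P X phi.
Local Open Scope ereal_scope.
Local Notation N := (log_tail (P := P) X).

Let mX : measurable_fun setT (X : T -> R). Proof. exact: measurable_funPT. Qed.

Let mNX : measurable_fun setT (fun w => - X w)%R.
Proof. exact: measurable_funN. Qed.

Let mabsX : measurable_fun setT (fun w => `|X w|%R).
Proof. exact: measurableT_comp. Qed.

Let prfin (A : set T) : measurable A -> P A = (fine (P A))%:E.
Proof. by move=> mA; rewrite fineK// fin_num_measure. Qed.

Lemma tail_abs (s : R) : (0 < s)%R ->
  P [set w | (s <= `|X w|)%R] = P [set w | (s <= X w)%R] + P [set w | (s <= X w)%R].
Proof.
move=> s0; exact: prob_abs_ge mX s0 (nc_sym nc s).
Qed.

Lemma prob_ge0_half : (1/2)%:E <= P [set w | (0 <= X w)%R].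
Proof.
have m0 := measurable_ge 0%R mX.
have : P ([set w | (0 <= X w)%R] `|` [set w | (0 <= - X w)%R]) <=
    P [set w | (0 <= X w)%R] + P [set w | (0 <= - X w)%R].
  by apply: measureU2; exact: measurable_ge.
rewrite -(nc_sym nc).
have -> : [set w | (0 <= X w)%R] `|` [set w | (0 <= - X w)%R] = setT.
  by apply/seteqP; split => w //= _; have [?|?] := leP 0%R (X w); [left|right; lra].
by rewrite prob_setT (prfin m0) -EFinD !lee_fin; lra.
Qed.

(** For m > 0 this is submultiplicativity of the tail of |X|, halved by symmetry. For -50 <= m <= 0
    it follows from P(X >= m) >= 1/2 and m + t >= t - 50; the loss of 50 pays for base points left
    of the origin. *)
Lemma prob_shift (m t : R) : (-50 <= m)%R -> (100 <= t)%R ->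
  P [set w | (m + t <= X w)%R] <=
  P [set w | (m <= X w)%R] * P [set w | (t - 50 <= `|X w|)%R].
Proof.
move=> m50 t100.
have mge s := measurable_ge s mX; have mab s := measurable_ge s mabsX.
have mono (s u : R) : (s <= u)%R -> P [set w | (u <= X w)%R] <= P [set w | (s <= X w)%R].
  move=> su; apply: le_measure; rewrite ?inE//.
  by move=> w /=; exact: le_trans.
have [m0|m0] := leP m 0%R.
  have hm : (1/2)%:E <= P [set w | (m <= X w)%R].
    by apply: le_trans prob_ge0_half _; exact: mono.
  have ht : P [set w | (m + t <= X w)%R] <= P [set w | (t - 50 <= X w)%R] by apply: mono; lra.
  rewrite tail_abs; last by lra.
  move: hm ht; rewrite (prfin (mge m)) (prfin (mge (m + t)%R)) (prfin (mge (t - 50)%R)).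
  rewrite -EFinD -EFinM !lee_fin => hm ht.
  have : (0 <= fine (P [set w | t - 50 <= X w]))%R by rewrite fine_ge0.
  by nra.
have := nc_mul nc (ltW m0) (_ : 0 <= t)%R => /(_ _)/wrap[]; first by lra.
have : P [set w | (t <= `|X w|)%R] <= P [set w | (t - 50 <= `|X w|)%R].
  by apply: le_measure; rewrite ?inE// => w /=; lra.
rewrite [P [set w | (m + t <= `|X w|)%R]]tail_abs; last by lra.
rewrite [P [set w | (m <= `|X w|)%R]]tail_abs//.
rewrite (prfin (mge m)) (prfin (mge (m + t)%R)) (prfin (mab (t - 50)%R)) (prfin (mab t)).
rewrite -!EFinD -!EFinM !lee_fin.
have : (0 <= fine (P [set w | m <= X w]))%R by rewrite fine_ge0.
by nra.
Qed.

Lemma tail_le_exp (t : R) : (1 < t)%R ->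
  P [set w | (t <= `|X w|)%R] <= (expR (- t))%:E.
Proof.
move=> t1; rewrite tail_log_tail (_ : (expR (- t))%:E = expeR (- t%:E))//.
by rewrite lee_expeR leeN2; exact: (nc_lin nc).
Qed.

(** The proof of the unshifted moment bound, run with c = P(X >= m): by [prob_shift] the tail at t
    factors into c and the tail of |X| at t - m - 50. *)
Lemma shifted_moment_le (m : R) : (-50 <= m)%R ->
  \int[P]_(w in [set w | (m + 100 <= X w)%R]) expeR ((1/2)%:E * N (X w - m - 50)%R)
  <= 3%:E * P [set w | (m <= X w)%R].
Proof.
move=> m50; set D := [set w | (m + 100 <= X w)%R].
have mD : measurable D by exact: measurable_ge.
have ndN : {homo (fun x => expeR ((1/2)%:E * N (x - m - 50)%R)) : x y / (x <= y)%R >-> x <= y}.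
  move=> x y xy; rewrite lee_expeR; apply: lee_wpmul2l; first by rewrite lee_fin; lra.
  by apply: log_tail_nd; lra.
have mN : measurable_fun setT (fun w => expeR ((1/2)%:E * N (X w - m - 50)%R)).
  exact: (measurableT_comp (nd_measurable ndN) mX).
set U := fun w => expeR _.
have mm : measurable [set w | (m <= X w)%R] by exact: measurable_ge.
rewrite (prfin mm) -EFinM integral_mkcond.
have UD w : (U \_ D) w = if (m + 100 <= X w)%R then U w else 0.
  by rewrite patchE; case: ifPn; rewrite ?inE ?notin_setE /D/= => h; [rewrite h|case: ifPn].
have gtD (r : R) : (0 <= r)%R -> [set w | r%:E < (U \_ D) w] =
    (X : T -> R) @^-1` [set x | (m + 100 <= x)%R /\ r%:E < expeR ((1/2)%:E * N (x - m - 50)%R)].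
  move=> r0; apply/seteqP; split => w; rewrite /= UD; last by move=> [-> ].
  by case: ifPn => //; rewrite ltNge lee_fin r0.
have P0 := prob_shift m50.
have uS (r : R) x y : (m + 100 <= x)%R /\ r%:E < expeR ((1/2)%:E * N (x - m - 50)%R) -> (x <= y)%R ->
    (m + 100 <= y)%R /\ r%:E < expeR ((1/2)%:E * N (y - m - 50)%R).
  by move=> [mx rx] xy; split; [lra|exact: lt_le_trans rx (ndN _ _ xy)].
have le_t (t : R) : (m + 100 <= t)%R -> P [set w | (t <= X w)%R] <=
    (fine (P [set w | (m <= X w)%R]))%:E * P [set w | (t - m - 50 <= `|X w|)%R].
  move=> mt; have := @prob_shift m (t - m) m50; rewrite -(prfin mm).
  by rewrite (_ : m + (t - m) = t)%R; [apply; lra|lra].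
apply: integral_le_of_dyadic_tail.
- by apply/(measurable_restrictT _ _).1 => //; exact: measurable_funTS.
- by move=> w; rewrite UD; case: ifP => // _; exact: expeR_ge0.
- by rewrite fine_ge0.
- rewrite (gtD 0%R)//; apply: prob_upset => //; first exact: uS.
    by rewrite lee_fin fine_ge0.
  move=> t [mt _]; apply: le_trans (le_t _ mt) _.
  rewrite -[leRHS]mule1; apply: lee_wpmul2l; first by rewrite lee_fin fine_ge0.
  by apply: probability_le1; exact: measurable_ge.
- move=> k; rewrite gtD ?exprn_ge0//; apply: prob_upset => //; first exact: uS.
    by rewrite lee_fin divr_ge0// ?exprn_ge0// fine_ge0.
  move=> t [mt /tail_le_pow kt]; apply: le_trans (le_t _ mt) _.
  by rewrite EFinM; apply: lee_wpmul2l => //; rewrite lee_fin fine_ge0.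
Qed.

(** The Hardy-type inequality. If G(t - 100) > r, then P(X >= t) is at most e^-50 P(X >= t - 100),
    and X >= t - 100 forces G(X) > r; compare level by level. *)
Lemma integral_shift_le (G : R -> R) (z : R) : {homo G : x y / (x <= y)%R} ->
  (forall x, 0 <= G x)%R -> (forall x, x <= z -> G x = 0)%R -> (-50 <= z)%R ->
  \int[P]_w (G (X w - 100)%R)%:E <= (expR (-50))%:E * \int[P]_w (G (X w))%:E.
Proof.
move=> ndG G0 Gz z50.
have mG : measurable_fun setT G.
  apply/measurable_EFinP; apply: nd_measurable => x y xy.
  by rewrite lee_fin ndG.
have mGX : measurable_fun setT (fun w => G (X w)) by exact: measurableT_comp.
have mGX' : measurable_fun setT (fun w => G (X w - 100)%R).
  by apply: (@measurableT_comp _ _ _ _ _ _ G _ (fun w => X w - 100)%R) => //; exact: measurable_funB.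
apply: (@tail_comparison _ _ _ P (fun w => G (X w - 100)%R) (fun w => G (X w)) (expR (-50))%R mGX' mGX).
- by move=> w; exact: G0.
- by move=> w; exact: G0.
- exact: expR_ge0.
move=> r r0.
apply: (@prob_upset _ _ _ _ (X : T -> R) [set x | (r < G (x - 100)%R)%R]) => //.
- by move=> x y /= rx xy; apply: (lt_le_trans rx); apply: ndG; lra.
- by rewrite mule_ge0// lee_fin expR_ge0.
move=> t /= rt.
have zt : (z < t - 100)%R.
  by rewrite ltNge; apply/negP => tz; move: rt; rewrite (Gz _ tz); lra.
have h50 : P [set w | (100 - 50 <= `|X w|)%R] <= (expR (-50))%:E.
  apply: (le_trans (tail_le_exp _)); first by lra.
  by rewrite lee_fin ler_expR; lra.
have t50 : (-50 <= t - 100)%R by lra.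
have := prob_shift t50 (lexx 100%R); rewrite subrK => /le_trans; apply.
rewrite muleC; apply: lee_pmul => //.
apply: le_measure; rewrite ?inE; [exact: measurable_ge|exact: measurable_gt|].
by move=> w /= tw; apply: (lt_le_trans rt); exact: ndG.
Qed.

End shift.

(** * The half-line estimate *)

Section halfline.
Context d (T : measurableType d) (R : realType) (P : probability T R).
Variables (X : {RV P >-> R}) (phi : R -> \bar R).
Hypothesis nc : normalized_cost P X phi.
Local Notation N := (log_tail (P := P) X).

Let mX : measurable_fun setT (X : T -> R). Proof. exact: measurable_funPT. Qed.

Variables (F q : R -> R) (z : R) (D : set T).
Hypothesis cF : cvx F.
Hypothesis Fz : forall y, y <= z -> F y = 0.
Hypothesis z50 : -50 <= z.
Hypothesis q_near : forall x y, z <= y -> x - 100 <= y -> y <= x ->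
  q x <= F y + ((x - y) / 100) ^+ 2 / 560.
Hypothesis q_far : forall x y, z <= y -> y + 100 <= x ->
  ((q x)%:E <= (F y)%:E + phi (x - y))%E.
Hypothesis mq : measurable_fun setT (q \o X).
Hypothesis mD : measurable D.
(** D lies between {X > z} and {X >= z}. The endpoint is left free so that the two sides of a base
    point can partition the space. *)
Hypothesis Dz : forall w, D w -> z <= X w.
Hypothesis zD : forall w, z < X w -> D w.

Let F0 : forall y, 0 <= F y := (cvx_ge0_nd cF Fz).1.
Let ndF : {homo F : x y / x <= y} := (cvx_ge0_nd cF Fz).2.

(** The square of the truncation g of F at height h = 1/100. *)
Let G x := Num.min (F x) (1/100) ^+ 2.

Let G0 x : 0 <= G x. Proof. exact: sqr_ge0. Qed.

Let G1 x : G x <= (1/100) ^+ 2.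
Proof. by rewrite /G lerXn2r ?nnegrE ?le_min ?F0 ?ge_min ?lexx ?orbT//=; lra. Qed.

Let ndG : {homo G : x y / x <= y}.
Proof.
move=> x y xy; rewrite /G lerXn2r ?nnegrE ?le_min ?F0//=.
by rewrite ge_min ndF// ge_min lexx orbT.
Qed.

Let Gz x : x <= z -> G x = 0.
Proof. by move=> xz; rewrite /G Fz// min_l ?expr0n//; lra. Qed.

Let mG : measurable_fun setT G.
Proof.
by apply/measurable_EFinP; apply: nd_measurable => x y xy; rewrite lee_fin ndG.
Qed.

Let mGX : measurable_fun setT (fun w => (G (X w))%:E).
Proof. by apply/measurable_EFinP; exact: measurableT_comp. Qed.

Let mGX' : measurable_fun setT (fun w => (G (X w - 100))%:E).
Proof.
apply/measurable_EFinP; apply: (measurableT_comp mG).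
exact: measurable_funB.
Qed.

(** Carries e^q at the points beyond the reach of [interpolation_gain], which needs F(x - 100) <=
    1/100. *)
Let far w := if 1/100 < F (X w - 100) then expR (q (X w)) else 0.

Let far0 w : 0 <= far w. Proof. by rewrite /far; case: ifP => // _; exact: expR_ge0. Qed.

Let mfar : measurable_fun setT (fun w => (far w)%:E).
Proof.
apply/measurable_EFinP; apply: measurable_fun_ifT => //.
- apply: measurable_fun_ltr => //.
  apply: (@cvx_measurable_comp _ _ _ F (fun w => X w - 100)) => //.
  exact: measurable_funB.
- by apply: measurableT_comp mq; exact: measurable_expR.
Qed.

Let pointwise w : D w ->
  expR (q (X w)) + expR (- F (X w)) + 68 * G (X w) <=
  2 + 726 * G (X w - 100) + far w.
Proof.
move=> /Dz; rewrite /far /G; set x := X w => zx.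
have [rh|hr] := leP (F (x - 100)) (1/100).
  rewrite addr0.
  apply: interpolation_gain; first by rewrite F0.
    by apply: ndF; lra.
  move=> l /andP[l0 l1].
  have [zy|yz] := leP z (x - 100 * l).
    have h1 : x - 100 <= x - 100 * l by lra.
    have h2 : x - 100 * l <= x by lra.
    have := q_near zy h1 h2.
    have := cF (x - 100) x (t := l); rewrite l0 l1 => /(_ isT).
    rewrite (_ : l * (x - 100) + (1 - l) * x = x - 100 * l); last by lra.
    rewrite (_ : (x - (x - 100 * l)) / 100 = l); last by lra.
    lra.
  (* When x - 100 l falls left of z, the competitor y = z does at least as well: F z = 0 and (x -
     z)/100 <= l. *)
  have h1 : x - 100 <= z by nra.
  have := q_near (lexx z) h1 zx.
  rewrite (Fz (lexx z)) add0r => qx.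
  have : ((x - z) / 100) ^+ 2 <= l ^+ 2.
    by rewrite lerXn2r ?nnegrE//; lra.
  have : l * F x <= 1 * F x by rewrite ler_wpM2r.
  have : 0 <= l * F (x - 100) by rewrite mulr_ge0.
  lra.
have hF : 1/100 <= F x by apply: (le_trans (ltW hr)); apply: ndF; lra.
rewrite (min_r hF).
have : expR (- F x) <= 1 by rewrite -expR0 ler_expR oppr_le0.
lra.
Qed.

(** With competitor m, q(x) <= 1/100 + n/1680 + 1/5 for n = N(x - m - 50), where x - m <= 2 (x - m -
    50) was used. As n >= x - m - 50 >= 50, this is at most n/2 - 20. *)
Let far_le (m : R) : F m = 1/100 -> forall w,
  ((far w)%:E <= if (m + 100 <= X w)%R
    then (expR (-20))%:E * expeR ((1/2)%:E * N (X w - m - 50)%R) else 0)%E.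
Proof.
move=> Fm w; rewrite /far; set x := X w.
have zm : z < m by rewrite ltNge; apply/negP => mz; move: Fm; rewrite Fz//; lra.
case: ifPn => hF; last by case: ifP => // _; rewrite mule_ge0// ?lee_fin ?expR_ge0// expeR_ge0.
have mx : m + 100 < x.
  by rewrite ltNge; apply/negP => xm; have : F (x - 100) <= F m; [apply: ndF; lra|lra].
rewrite (ltW mx).
have := q_far (ltW zm) (ltW mx); rewrite Fm.
have y0 : 0 < x - m - 50 by lra.
have u_le : (N ((x - m) / 840)%R <= (1/420)%:E * N (x - m - 50)%R)%E.
  apply: (@le_trans _ _ (N (1/420 * (x - m - 50))%R)); first by apply: log_tail_nd; lra.
  by apply: (nc_scale nc); [apply/andP; split; lra|lra].
have phi_le : (phi (x - m)%R <= (1/1680)%:E * N (x - m - 50)%R + (1/5)%:E)%E.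
  have := nc_tail nc (x - m); rewrite ger0_norm; last by lra.
  move=> /le_trans; apply; apply: leeD => //.
  rewrite (_ : (1/1680)%:E = (1/4)%:E * (1/420)%:E)%E; last by rewrite -EFinM; congr EFin; lra.
  by rewrite -muleA; apply: lee_wpmul2l => //; rewrite lee_fin; lra.
move=> /le_trans - /(_ _ (leeD (lexx _) phi_le)).
have : ((x - m - 50)%:E <= N (x - m - 50)%R)%E by apply: (nc_lin nc); lra.
case: (N (x - m - 50)%R) => [n| |]//.
- rewrite -!EFinM -!EFinD !lee_fin /= => nlin qv.
  by rewrite -expRD ler_expR; lra.
- move=> _ _; have h : (0 < (1/2)%:E :> \bar R)%E by rewrite lte_fin; lra.
  by rewrite (gt0_muley h)/= gt0_muley ?leey// lte_fin expR_gt0.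
Qed.

Local Open Scope ereal_scope.

(** A level m with F m = 1/100 exists by the intermediate value theorem unless [far] vanishes.
    Beyond m, G equals 10^-4, so P(X >= m) <= 10^4 E G(X), and 3 e^-20 <= 10^-5. *)
Let far_integral_le :
  \int[P]_(w in D) (far w)%:E <= (1/10)%:E * \int[P]_w (G (X w))%:E.
Proof.
have [nh|/existsNP[x0 /negP]] := pselect (forall x, F x <= 1/100)%R.
  rewrite integral0_eq; last by move=> w _; rewrite /far ltNge nh.
  by apply: mule_ge0; [rewrite lee_fin; lra|apply: integral_ge0 => w _; rewrite lee_fin].
rewrite -ltNge => hx0.
have zx0 : (z <= x0)%R.
  by rewrite leNgt; apply/negP => /ltW x0z; move: hx0; rewrite Fz//; lra.
have [||m _ Fm] := @IVT R F z x0 (1/100)%R zx0.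
- by apply: continuous_subspaceT; exact: cvx_continuous.
- by rewrite Fz// min_l ?F0// max_r ?F0//; apply/andP; split; lra.
have zm : (z < m)%R by rewrite ltNge; apply/negP => mz; move: Fm; rewrite Fz//; lra.
have m50 : (-50 <= m)%R by exact: le_trans z50 (ltW zm).
pose V w := if (m + 100 <= X w)%R
    then (expR (-20))%:E * expeR ((1/2)%:E * N (X w - m - 50)%R) else 0.
set E := [set w | (m + 100 <= X w)%R].
have mE : measurable E by exact: measurable_ge.
have mN : measurable_fun setT (fun w => expeR ((1/2)%:E * N (X w - m - 50)%R)).
  have ndN : {homo (fun x => expeR ((1/2)%:E * N (x - m - 50)%R)) : x y / (x <= y)%R >-> x <= y}.
    move=> x y xy; rewrite lee_expeR; apply: lee_wpmul2l; first by rewrite lee_fin; lra.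
    by apply: log_tail_nd; lra.
  exact: (measurableT_comp (nd_measurable ndN) mX).
have VE : V = (fun w => (expR (-20))%:E * expeR ((1/2)%:E * N (X w - m - 50)%R)) \_ E.
  apply/funext => w; rewrite patchE /V.
  by case: ifPn => h; [rewrite mem_set|rewrite memNset//; exact/negP].
have mV : measurable_fun setT V.
  rewrite VE; apply/(measurable_restrictT _ _).1 => //.
  by apply: measurable_funTS; exact: measurable_funeM.
have V0 w : 0 <= V w.
  by rewrite /V; case: ifP => // _; rewrite mule_ge0// ?lee_fin ?expR_ge0// expeR_ge0.
apply: (@le_trans _ _ (\int[P]_w V w)).
  apply: (@le_trans _ _ (\int[P]_(w in D) V w)); last exact: ge0_subset_integral.
  apply: ge0_le_integral => //.
  - by move=> w _; rewrite lee_fin.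
  - exact: measurable_funTS.
  - exact: measurable_funTS.
  - by move=> w _; exact: far_le.
rewrite VE -integral_mkcond ge0_integralZl//; last 2 first.
- exact: measurable_funTS.
- by move=> w _; exact: expeR_ge0.
have mm : measurable [set w | (m <= X w)%R] by exact: measurable_ge.
have GP : ((1/100) ^+ 2)%:E * P [set w | (m <= X w)%R] <= \int[P]_w (G (X w))%:E.
  rewrite -prob_integral_cst//.
  apply: (@le_trans _ _ (\int[P]_(w in [set w | (m <= X w)%R]) (G (X w))%:E)).
    apply: ge0_le_integral => //.
    - exact: measurable_funTS.
    - by move=> w /= mw; rewrite lee_fin /G min_r// -Fm; exact: ndF.
  by apply: ge0_subset_integral => // w _; rewrite lee_fin.
apply: (@le_trans _ _ ((expR (-20))%:E * (3%:E * P [set w | (m <= X w)%R]))).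
  apply: lee_wpmul2l; first by rewrite lee_fin expR_ge0.
  exact: (shifted_moment_le nc m50).
apply: (@le_trans _ _ ((1/10)%:E * (((1/100) ^+ 2)%:E * P [set w | (m <= X w)%R]))); last first.
  by apply: lee_wpmul2l => //; rewrite lee_fin; lra.
rewrite !muleA -!EFinM; apply: lee_wpmul2r => //; rewrite lee_fin.
have := @expRN_le_pow R 20; lra.
Qed.

Lemma expRN50 : (expR (-50) <= 1/1000 :> R)%R.
Proof.
apply: (@le_trans _ _ (expR (- 14%:R))); first by rewrite ler_expR; lra.
by apply: (le_trans (expRN_le_pow _ _)); lra.
Qed.

(** Integrate the pointwise bound. The shifted term costs at most 726 e^-50 <= 0.726 times E G(X)
    and the far term 0.1 times it, which leaves 67 of the 68. *)
Lemma halfline :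
  \int[P]_(w in D) (expR (q (X w)))%:E + \int[P]_(w in D) (expR (- F (X w)))%:E +
    67%:E * \int[P]_w (Num.min (F (X w)) (1/100) ^+ 2)%:E <= 2%:E * P D.
Proof.
have -> : \int[P]_w (Num.min (F (X w)) (1/100) ^+ 2)%:E = \int[P]_w (G (X w))%:E by [].
have mE (f : R -> R) : measurable_fun setT (f \o X) ->
    measurable_fun D (fun w => (expR (f (X w)))%:E).
  move=> mf; apply: measurable_funTS; apply/measurable_EFinP.
  exact: measurableT_comp mf.
have [c1 [c1E c10]] : exists c : R, c = 726%R /\ 0 <= c%:E.
  by exists 726%R; split; [by []|rewrite lee_fin; lra].
have [c2 [c2E c20]] : exists c : R, c = 68%R /\ 0 <= c%:E.
  by exists 68%R; split; [by []|rewrite lee_fin; lra].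
have mq' := mE q mq.
have mF' : measurable_fun D (fun w => (expR (- F (X w)))%:E).
  apply: (mE (fun x => - F x)%R); apply: measurable_funN.
  exact: cvx_measurable_comp.
have mGD := measurable_funTS (D := D) mGX.
have mGD' := measurable_funTS (D := D) mGX'.
have mfD := measurable_funTS (D := D) mfar.
have ID : \int[P]_(w in D) (G (X w))%:E = \int[P]_w (G (X w))%:E.
  rewrite integral_mkcond; apply: eq_integral => w _; rewrite patchE.
  case: ifPn => //; rewrite notin_setE => nD; congr EFin; rewrite Gz//.
  by rewrite leNgt; apply/negP => /zD.
have mGe : measurable_fun D (fun w => c2%:E * (G (X w))%:E) by exact: measurable_funeM.
have mGe' : measurable_fun D (fun w => c1%:E * (G (X w - 100)%R)%:E).
  exact: measurable_funeM.
have m1 : measurable_fun D (fun w => (expR (q (X w)))%:E + (expR (- F (X w)))%:E).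
  exact: emeasurable_funD.
have m2 : measurable_fun D
    (fun w => (expR (q (X w)))%:E + (expR (- F (X w)))%:E + c2%:E * (G (X w))%:E).
  exact: emeasurable_funD.
have m3 : measurable_fun D (fun w => 2%:E + c1%:E * (G (X w - 100)%R)%:E).
  exact: emeasurable_funD.
have m4 : measurable_fun D
    (fun w => 2%:E + c1%:E * (G (X w - 100)%R)%:E + (far w)%:E).
  exact: emeasurable_funD.
have p1 w : 0 <= (expR (q (X w)))%:E by rewrite lee_fin expR_ge0.
have p2 w : 0 <= (expR (- F (X w)))%:E by rewrite lee_fin expR_ge0.
have p3 w : 0 <= (G (X w))%:E by rewrite lee_fin.
have p4 w : 0 <= (G (X w - 100)%R)%:E by rewrite lee_fin.
have p5 w : 0 <= (far w)%:E by rewrite lee_fin.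
have p6 w : 0 <= c2%:E * (G (X w))%:E by rewrite mule_ge0.
have p7 w : 0 <= c1%:E * (G (X w - 100)%R)%:E by rewrite mule_ge0.
have : \int[P]_(w in D) ((expR (q (X w)))%:E + (expR (- F (X w)))%:E + c2%:E * (G (X w))%:E) <=
    \int[P]_(w in D) (2%:E + c1%:E * (G (X w - 100)%R)%:E + (far w)%:E).
  apply: ge0_le_integral => //.
  - by move=> w _; rewrite !adde_ge0.
  - by move=> w Dw; rewrite -!EFinM -!EFinD lee_fin c1E c2E; exact: pointwise.
have p8 w : D w -> 0 <= (expR (q (X w)))%:E + (expR (- F (X w)))%:E.
  by move=> _; rewrite adde_ge0.
have p9 w : D w -> 0 <= 2%:E + c1%:E * (G (X w - 100)%R)%:E.
  by move=> _; rewrite adde_ge0// lee_fin.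
rewrite ge0_integralD//.
rewrite ge0_integralD// ge0_integralZl//.
rewrite ge0_integralD//.
rewrite ge0_integralD//.
rewrite ge0_integralZl// prob_integral_cst// ID.
(* The upper bound makes E G(X) finite, so that the losses can be subtracted from the gain. *)
have GI : 0 <= \int[P]_w (G (X w))%:E <= ((1/100) ^+ 2)%:E.
  apply/andP; split; first by apply: integral_ge0 => w _; rewrite lee_fin.
  rewrite -[leRHS]mule1 -(prob_setT P) -prob_integral_cst//.
  by apply: ge0_le_integral => // w _; rewrite lee_fin.
have shiftI : \int[P]_(w in D) (G (X w - 100)%R)%:E <= (expR (-50))%:E * \int[P]_w (G (X w))%:E.
  apply: le_trans (integral_shift_le nc ndG G0 Gz z50).
  by apply: ge0_subset_integral => // w _; rewrite lee_fin.
have e50 := expRN50; have e0 := expR_ge0 (-50 : R).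
move: GI shiftI far_integral_le.
have P01 : P D \is a fin_num by rewrite fin_num_measure.
rewrite -(fineK P01).
case: (\int[P]_w (G (X w))%:E) => [g| |]//; rewrite ?leey_eq ?andbF// => /andP[g0 g1].
have S0 : 0 <= \int[P]_(w in D) (G (X w - 100)%R)%:E.
  by apply: integral_ge0 => w _; rewrite lee_fin.
have S1 : 0 <= \int[P]_(w in D) (far w)%:E by apply: integral_ge0 => w _; rewrite lee_fin.
have S2 : 0 <= \int[P]_(w in D) (expR (q (X w)))%:E.
  by apply: integral_ge0 => w _; rewrite lee_fin expR_ge0.
have S3 : 0 <= \int[P]_(w in D) (expR (- F (X w)))%:E.
  by apply: integral_ge0 => w _; rewrite lee_fin expR_ge0.
rewrite -!EFinM; move: S0 S1 S2 S3.
case: (\int[P]_(w in D) (G (X w - 100)%R)%:E) => [s| |]//.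
case: (\int[P]_(w in D) (far w)%:E) => [t| |]//.
rewrite -!EFinM -!EFinD.
case: (\int[P]_(w in D) (expR (q (X w)))%:E) => [a| |]//;
  case: (\int[P]_(w in D) (expR (- F (X w)))%:E) => [b| |]//.
move: g0 g1; rewrite -!EFinD !lee_fin c1E c2E => g0 g1.
have := ler_wpM2r g0 e50; lra.
Qed.

End halfline.

Section halfline_cost.
Context d (T : measurableType d) (R : realType) (P : probability T R).
Local Open Scope ereal_scope.

Lemma halfline_cost (X : {RV P >-> R}) (phi : R -> \bar R)
    (F q : R -> R) (z : R) (D : set T) :
  normalized_cost P X phi -> cvx F -> (forall y, (y <= z)%R -> F y = 0%R) -> (-50 <= z)%R ->
  (forall x y, (z <= y)%R -> (y <= x)%R -> (q x)%:E <= (F y)%:E + phi (x - y)%R) ->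
  measurable_fun setT (q \o X) -> measurable D ->
  (forall w, D w -> (z <= X w)%R) -> (forall w, (z < X w)%R -> D w) ->
  \int[P]_(w in D) (expR (q (X w)))%:E + \int[P]_(w in D) (expR (- F (X w)))%:E +
    67%:E * \int[P]_w (Num.min (F (X w)) (1/100) ^+ 2)%:E <= 2%:E * P D.
Proof.
move=> nc cF Fz z50 Hq mq mD Dz zD.
apply: (halfline nc cF Fz z50 _ _ mq mD Dz zD).
- move=> x y zy xy yx; have := Hq _ _ zy yx.
  have := @nc_quad _ _ _ _ _ _ nc (x - y)%R; rewrite ger0_norm; last by rewrite subr_ge0.
  move=> /(_ _)/wrap[]; first by lra.
  by case: (phi _) => [v| |]//; rewrite -EFinD !lee_fin; lra.
- by move=> x y zy yx; apply: Hq => //; apply: le_trans yx; rewrite lerDl.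
Qed.

End halfline_cost.

(** * Infimum convolution *)

Lemma rpart_ge (R : realType) (f : R -> R) z x : f z = 0 -> z <= x -> f x <= rpart f z x.
Proof.
move=> fz; rewrite le_eqVlt => /orP[/eqP <-|zx]; first by rewrite fz /rpart ltxx.
by rewrite /rpart zx le_max lexx.
Qed.

Lemma rpart_left (R : realType) (f : R -> R) z x : x <= z -> rpart f z x = 0.
Proof. by rewrite /rpart leNgt => /negbTE ->. Qed.

Section inf_conv.
Variables (R : realType) (phi : R -> \bar R) (f : R -> R).
Hypothesis phi_ge0 : forall x, (0 <= phi x)%E.
Hypothesis phi0 : (phi 0%R <= 0)%E.
Hypothesis cphi : econvex_function setT phi.
Hypothesis cf : cvx f.
Hypothesis bf : has_lbound (range f).
Local Open Scope ereal_scope.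

Lemma inf_conv_le x y : inf_conv f phi x <= (f y)%:E + phi (x - y)%R.
Proof. by apply: ereal_inf_lbound; exists y. Qed.

Lemma inf_conv_le_id x : inf_conv f phi x <= (f x)%:E.
Proof.
apply: (le_trans (inf_conv_le x x)); rewrite subrr -[leRHS]adde0; exact: leeD.
Qed.

Lemma inf_conv_fin x : inf_conv f phi x = (fine (inf_conv f phi x))%:E.
Proof.
rewrite fineK// fin_numE; apply/andP; split.
  have [l lf] := bf; apply/eqP => E.
  suff : l%:E <= inf_conv f phi x by rewrite E leeNy_eq.
  apply: le_ereal_inf_tmp => _ [y _ <-]; rewrite -[leLHS]adde0; apply: leeD.
    by rewrite lee_fin; apply: lf; exists y.
  exact: phi_ge0.
by rewrite lt_eqF// (le_lt_trans (inf_conv_le_id x))// ltry.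
Qed.

(** Near-minimizers for x and for y, mixed with weights t and 1 - t, form a competitor at the
    mixture; the slack e is arbitrary. *)
Lemma inf_conv_cvx : cvx (fun x => fine (inf_conv f phi x)).
Proof.
move=> x y t t01; apply/ler_addgt0Pr => e e0.
have near_inf u : exists v a, phi (u - v)%R = a%:E /\
    (f v + a < fine (inf_conv f phi u) + e)%R.
  have : inf_conv f phi u < (fine (inf_conv f phi u) + e)%:E.
    by rewrite {1}inf_conv_fin lte_fin ltrDl.
  move=> /ereal_inf_lt[_ [v _ <-]] h; exists v; move: h.
  have := phi_ge0 (u - v)%R; case: (phi (u - v)%R) => [a| |]// _.
  by rewrite -EFinD lte_fin => h; exists a.
have [u [a [ha hu]]] := near_inf x; have [v [b [hb hv]]] := near_inf y.
have := inf_conv_le (t * x + (1 - t) * y)%R (t * u + (1 - t) * v)%R.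
rewrite inf_conv_fin (_ : t * x + (1 - t) * y - (t * u + (1 - t) * v) =
  t * (x - u) + (1 - t) * (y - v))%R; last by lra.
have := @cphi (x - u)%R (y - v)%R t I I t01.
have := phi_ge0 (t * (x - u) + (1 - t) * (y - v))%R.
rewrite ha hb -!EFinM -EFinD.
case: (phi (t * (x - u) + (1 - t) * (y - v))%R) => [c| |]// _.
rewrite -EFinD !lee_fin => pc qc; have fc := cf u v t01.
move/andP: t01 => [t0 t1].
have : (t * (f u + a) <= t * (fine (inf_conv f phi x) + e))%R by rewrite ler_wpM2l// ltW.
have : ((1 - t) * (f v + b) <= (1 - t) * (fine (inf_conv f phi y) + e))%R.
  by rewrite ler_wpM2l ?subr_ge0// ltW.
lra.
Qed.

End inf_conv.

(** * Small slope near the origin *)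

Lemma normalized_costN d (T : measurableType d) (R : realType) (P : probability T R)
    (X : {RV P >-> R}) (phi : R -> \bar R) :
  normalized_cost P X phi -> normalized_cost P (\- X)%R phi.
Proof.
move=> [sym mul one lin scale ge0 even conv quad tail].
have absE t : [set w | t <= `|(\- X) w|] = [set w | t <= `|X w|].
  by apply/seteqP; split => w /=; rewrite normrN.
have LE t : log_tail (P := P) (\- X)%R t = log_tail (P := P) X t by rewrite /log_tail absE.
split=> //.
- by move=> t; rewrite -sym; congr (P _); apply/seteqP; split => w /=; rewrite opprK.
- by move=> s t s0 t0; rewrite !absE; exact: mul.
- by rewrite absE.
- by move=> t t1; rewrite LE; exact: lin.
- by move=> c t c01 t0; rewrite !LE; exact: scale.
- by move=> x; rewrite LE; exact: tail.
Qed.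

Section near.
Context d (T : measurableType d) (R : realType) (P : probability T R).
Variables (X : {RV P >-> R}) (phi : R -> \bar R) (f q : R -> R) (p x1 : R).
Hypothesis nc : normalized_cost P X phi.
Hypothesis cf : cvx f.
Hypothesis cq : cvx q.
Hypothesis q_le : forall x y, ((q x)%:E <= (f y)%:E + phi (x - y)%R)%E.
Hypothesis p01 : 0 <= p <= 1/100.
Hypothesis x01 : 0 <= x1 <= 50.
Hypothesis fx1 : f x1 = 0.
Hypothesis f_ge : forall x, - (p * (x - x1)) <= f x.

Let mX : measurable_fun setT (X : T -> R). Proof. exact: measurable_funPT. Qed.

Let phi0 : (phi 0 <= 0)%E.
Proof.
have := @nc_quad _ _ _ _ _ _ nc 0%R; rewrite normr0 mul0r expr0n/= mul0r.
by apply; exact: ler0n.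
Qed.

Let q_le_f x : q x <= f x.
Proof.
by have := leeD (lexx (f x)%:E) phi0; rewrite -lee_fin adde0; apply: le_trans;
  have := q_le x x; rewrite subrr.
Qed.

Local Open Scope ereal_scope.

Let mexp (g : R -> R) : cvx g -> measurable_fun setT (fun w => (expR (g (X w)))%:E).
Proof.
move=> cg; apply/measurable_EFinP; apply: (measurableT_comp (@measurable_expR R)).
exact: cvx_measurable_comp.
Qed.

Let mexpN (g : R -> R) : cvx g -> measurable_fun setT (fun w => (expR (- g (X w)))%:E).
Proof.
move=> cg; apply/measurable_EFinP; apply: (measurableT_comp (@measurable_expR R)).
by apply: measurable_funN; exact: cvx_measurable_comp.
Qed.

(** After reflection f is nonnegative on this side, and the half-line gain is kept: where X <= -1
    the reflected f is at least p <= 1/100, an event of probability at least 1/6, so the gain is at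
    least 67 p^2 / 6. *)
Let left_part :
  \int[P]_(w in [set w | (X w < x1)%R]) (expR (q (X w)))%:E +
  \int[P]_(w in [set w | (X w < x1)%R]) (expR (- f (X w)))%:E + (67/6 * p ^+ 2)%:E
  <= 2%:E * P [set w | (X w < x1)%R].
Proof.
have /andP[p0 p1] := p01; have /andP[x10 x150] := x01.
pose fm x := f (- x)%R.
have cfm : cvx fm by exact: cvx_opp.
have fmz : fm (- x1)%R = 0%R by rewrite /fm opprK.
pose F := rpart fm (- x1)%R.
have cF : cvx F by exact: rpart_cvx.
have Fge x : (- x1 <= x)%R -> (fm x <= F x)%R by exact: rpart_ge.
have Fpos x : (- x1 < x)%R -> F x = fm x.
  move=> xx; rewrite /F /rpart xx max_l// /fm.
  apply: le_trans (f_ge (- x)).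
  by rewrite -mulrN mulr_ge0//; lra.
have mDL : measurable [set w | (X w < x1)%R] by exact: measurable_lt.
have z50 : (-50 <= - x1)%R by lra.
have Hq x y : (- x1 <= y)%R -> (y <= x)%R -> (q (- x))%:E <= (F y)%:E + phi (x - y)%R.
  move=> zy yx; apply: le_trans (q_le (- x)%R (- y)%R) _.
  rewrite (_ : - x - - y = - (x - y))%R; last by lra.
  by rewrite (nc_even nc); apply: leeD => //; rewrite lee_fin; exact: Fge.
have mqm : measurable_fun setT ((fun x => q (- x)%R) \o (\- X)%R).
  rewrite (_ : _ \o _ = q \o X); first exact: cvx_measurable_comp.
  by apply/funext => w /=; rewrite opprK.
have Dz w : [set w | (X w < x1)%R] w -> (- x1 <= (\- X)%R w)%R by move=> /=; lra.
have zD w : (- x1 < (\- X)%R w)%R -> [set w | (X w < x1)%R] w by move=> /=; lra.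
have := halfline_cost (normalized_costN nc) cF (@rpart_left _ fm (- x1)%R) z50 Hq mqm mDL Dz zD.
under eq_integral do rewrite /= opprK.
have -> : \int[P]_(w in [set w | (X w < x1)%R]) (expR (- F ((\- X)%R w)))%:E =
    \int[P]_(w in [set w | (X w < x1)%R]) (expR (- f (X w)))%:E.
  by apply: eq_integral => w; rewrite inE/= => wx; rewrite Fpos ?/fm ?opprK// ltrN2.
apply: le_trans; apply: leeD => //.
have m1 := measurable_ge 1%R (measurable_funN mX).
have P6 : (1/6)%:E <= P [set w | (1 <= - X w)%R].
  rewrite -(nc_sym nc); have := nc_one nc; rewrite (tail_abs nc)//.
  have m1' := measurable_ge 1%R mX.
  have pf : P [set w | (1 <= X w)%R] = (fine (P [set w | (1 <= X w)%R]))%:E.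
    by rewrite fineK// fin_num_measure.
  by rewrite pf -EFinD !lee_fin; lra.
apply: (@le_trans _ _ (67%:E * ((p ^+ 2)%:E * P [set w | (1 <= - X w)%R]))).
  apply: (@le_trans _ _ (67%:E * ((p ^+ 2)%:E * (1/6)%:E))).
    by rewrite -!EFinM lee_fin; lra.
  apply: lee_wpmul2l; first by rewrite lee_fin; lra.
  by apply: lee_wpmul2l => //; rewrite lee_fin sqr_ge0.
apply: lee_wpmul2l; first by rewrite lee_fin; lra.
have mFX : measurable_fun setT (fun w => (Num.min (F ((\- X)%R w)) (1/100) ^+ 2)%:E).
  apply/measurable_EFinP; apply: measurable_funX; apply: measurable_minr => //.
  apply: (@cvx_measurable_comp _ _ _ F (\- X)%R) => //; exact: measurable_funN.
rewrite -prob_integral_cst//.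
apply: (@le_trans _ _ (\int[P]_(w in [set w | (1 <= - X w)%R])
    (Num.min (F ((\- X)%R w)) (1/100) ^+ 2)%:E)); last first.
  by apply: ge0_subset_integral => // w _; rewrite lee_fin sqr_ge0.
apply: ge0_le_integral => //.
- by move=> w _; rewrite lee_fin sqr_ge0.
- exact: measurable_funTS.
move=> w /= w1; rewrite lee_fin.
have Fp : (p <= F (- X w))%R.
  rewrite Fpos; last by lra.
  rewrite /fm opprK; apply: le_trans (f_ge (X w)).
  rewrite -mulrN -[leLHS]mulr1 ler_wpM2l//; lra.
by rewrite lerXn2r ?nnegrE ?le_min ?Fp//=; lra.
Qed.

(** Where f > 0 the half-line estimate applies. Where f <= 0, a = -f is at most p X, and e^a +
    e^(-a) - 2 <= a^2 e^a <= 27/10 p^2 e^(X/2), whose expectation is bounded by 27/10 p^2 (1 +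
    3). *)
Let right_part :
  \int[P]_(w in [set w | (x1 <= X w)%R]) (expR (q (X w)))%:E +
  \int[P]_(w in [set w | (x1 <= X w)%R]) (expR (- f (X w)))%:E
  <= 2%:E * P [set w | (x1 <= X w)%R] + (108/10 * p ^+ 2)%:E.
Proof.
set D := [set w | (x1 <= X w)%R].
have mD : measurable D by exact: measurable_ge.
have /andP[p0 p1] := p01; have /andP[x10 x150] := x01.
pose F := rpart f x1.
have cF : cvx F by exact: rpart_cvx.
(* Setting q to 0 where f <= 0 matches F = 0 there, so those points contribute exactly 2 and their
   true excess is charged separately. *)
pose q' x := if (0 < f x)%R then q x else 0%R.
have mq' : measurable_fun setT (q' \o X).
  apply: measurable_fun_ifT => /=.
  - by apply: measurable_fun_ltr => //; exact: cvx_measurable_comp.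
  - exact: cvx_measurable_comp.
  - exact: measurable_cst.
have F0 : forall y, (0 <= F y)%R := (cvx_ge0_nd cF (@rpart_left _ f x1)).1.
have z50 : (-50 <= x1)%R by lra.
have Hq x y : (x1 <= y)%R -> (y <= x)%R -> (q' x)%:E <= (F y)%:E + phi (x - y)%R.
  move=> zy yx; rewrite /q'; case: ifPn => _.
    by apply: le_trans (q_le x y) _; apply: leeD => //; rewrite lee_fin; exact: rpart_ge.
  by rewrite adde_ge0 ?lee_fin//; exact: (nc_ge0 nc).
have zD w : (x1 < X w)%R -> D w by move/ltW.
have key := halfline_cost nc cF (@rpart_left _ f x1) z50 Hq mq' mD (fun _ => id) zD.
have h0 : (0 <= 1/2 :> R)%R by lra.
have mJ : measurable_fun setT (tail_moment P X (1/2)) by exact: tail_moment_measurable.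
have J1 w : 1 <= tail_moment P X (1/2) w by exact: tail_moment_ge1.
have J0 w : 0 <= tail_moment P X (1/2) w.
  by apply: le_trans (J1 w); rewrite lee01.
pose c := (27/10 * p ^+ 2)%R.
have c0 : 0 <= c%:E by rewrite lee_fin mulr_ge0 ?sqr_ge0//; lra.
have mJ1 : measurable_fun setT (fun w => 1 + tail_moment P X (1/2) w).
  exact: emeasurable_funD.
have lossI : \int[P]_(w in D) (c%:E * (1 + tail_moment P X (1/2) w)) <= (108/10 * p ^+ 2)%:E.
  apply: (@le_trans _ _ (\int[P]_w (c%:E * (1 + tail_moment P X (1/2) w)))).
    apply: ge0_subset_integral => //; first exact: measurable_funeM.
    by move=> w _; rewrite mule_ge0// adde_ge0.
  rewrite ge0_integralZl//; last by move=> w _; rewrite adde_ge0.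
  rewrite ge0_integralD// prob_integral_cst// prob_setT mule1.
  apply: (@le_trans _ _ (c%:E * (1 + 3%:E))).
    by apply: lee_wpmul2l => //; apply: leeD => //; exact: tail_moment_half_le.
  by rewrite -EFinD -EFinM lee_fin /c; lra.
have mq1 := measurable_funTS (D := D) (mexp cq).
have mf1 := measurable_funTS (D := D) (mexpN cf).
have mF1 := measurable_funTS (D := D) (mexpN cF).
have mq2 : measurable_fun D (fun w => (expR (q' (X w)))%:E).
  apply: measurable_funTS; apply/measurable_EFinP.
  exact: (measurableT_comp (@measurable_expR R) mq').
have mJD : measurable_fun D (fun w => c%:E * (1 + tail_moment P X (1/2) w)).
  by apply: measurable_funTS; exact: measurable_funeM.
have e0 (u : R) : 0 <= (expR u)%:E by rewrite lee_fin expR_ge0.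
have mqf2 : measurable_fun D (fun w => (expR (q' (X w)))%:E + (expR (- F (X w)))%:E).
  exact: emeasurable_funD.
rewrite -ge0_integralD//.
apply: (@le_trans _ _ (\int[P]_(w in D) ((expR (q' (X w)))%:E + (expR (- F (X w)))%:E +
    c%:E * (1 + tail_moment P X (1/2) w)))).
  apply: ge0_le_integral => //.
  - by move=> w _; rewrite adde_ge0.
  - exact: emeasurable_funD.
  - exact: emeasurable_funD.
  move=> w /= xw; have [fp|fn] := ltP 0%R (f (X w)).
    have xw' : (x1 < X w)%R.
      by rewrite lt_neqAle xw andbT; apply/eqP => E; move: fp; rewrite -E fx1 ltxx.
    have -> : q' (X w) = q (X w) by rewrite /q' fp.
    have -> : F (X w) = f (X w) by rewrite /F /rpart xw' max_l// ltW.
    by rewrite leeDl// mule_ge0// adde_ge0.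
  have -> : q' (X w) = 0%R by rewrite /q' ltNge fn.
  have -> : F (X w) = 0%R.
    by rewrite /F /rpart; case: ifP => // _; rewrite max_r.
  have X0 : (0 <= X w)%R by exact: le_trans x10 xw.
  apply: (@le_trans _ _ ((1 + 1) + c%:E * (expR (`|X w| / 2))%:E)); last first.
    rewrite oppr0 expR0; apply: leeD => //; apply: lee_wpmul2l => //.
    by apply: expR_abs_le; exact: (nc_lin nc).
  rewrite -EFinM -!EFinD lee_fin ger0_norm//.
  have a0 : (0 <= - f (X w))%R by lra.
  have := expR_sym_le a0; rewrite opprK => h.
  have hq : (expR (q (X w)) <= expR (f (X w)))%R by rewrite ler_expR.
  have ap : (- f (X w) <= p * X w)%R.
    have := f_ge (X w); have : (0 <= p * x1)%R by rewrite mulr_ge0.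
    by lra.
  have a2 : ((- f (X w)) ^+ 2 <= p ^+ 2 * X w ^+ 2)%R.
    by rewrite -exprMn lerXn2r ?nnegrE// mulr_ge0.
  have ea : (expR (- f (X w)) <= expR (X w / 100))%R.
    rewrite ler_expR (le_trans ap)// mulrC ler_wpM2l//; lra.
  have : ((- f (X w)) ^+ 2 * expR (- f (X w)) <= p ^+ 2 * X w ^+ 2 * expR (X w / 100))%R.
    by rewrite ler_pM ?sqr_ge0 ?expR_ge0.
  have : (p ^+ 2 * (X w ^+ 2 * expR (X w / 100)) <= p ^+ 2 * (27/10 * expR (X w / 2)))%R.
    by rewrite ler_wpM2l ?sqr_ge0// sqr_expR_le.
  by rewrite /c; lra.
rewrite ge0_integralD//; [|by move=> w _; rewrite adde_ge0|by move=> w _; rewrite mule_ge0// adde_ge0].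
apply: leeD => //; rewrite ge0_integralD//.
apply: le_trans key; apply: leeDl.
apply: mule_ge0; first by rewrite lee_fin; lra.
by apply: integral_ge0 => w _; rewrite lee_fin; exact: sqr_ge0.
Qed.

Lemma near_normalized :
  \int[P]_w (expR (q (X w)))%:E + \int[P]_w (expR (- f (X w)))%:E <= 2%:E.
Proof.
have mL : measurable [set w | (X w < x1)%R] by exact: measurable_lt.
have mR : measurable [set w | (x1 <= X w)%R] by exact: measurable_ge.
have LR : [set w | (X w < x1)%R] `|` [set w | (x1 <= X w)%R] = setT.
  by apply/seteqP; split => w //= _; case: (ltP (X w) x1); [left|right].
have dLR : [disjoint [set w | (X w < x1)%R] & [set w | (x1 <= X w)%R]].
  by apply/disj_setPS => w /= []; rewrite leNgt => ->.
have split_int (g : R -> R) : measurable_fun setT (fun w => (expR (g (X w)))%:E) ->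
    \int[P]_w (expR (g (X w)))%:E = \int[P]_(w in [set w | (X w < x1)%R]) (expR (g (X w)))%:E +
      \int[P]_(w in [set w | (x1 <= X w)%R]) (expR (g (X w)))%:E.
  move=> mg; rewrite -LR ge0_integral_setU//; first by rewrite LR.
rewrite (split_int q (mexp cq)) (split_int (fun x => - f x)%R (mexpN cf)).
have PLR : P [set w | (X w < x1)%R] + P [set w | (x1 <= X w)%R] = 1.
  rewrite -(prob_setT P) -LR measureU//.
  by apply/seteqP; split => // w [/=]; rewrite ltNge => /negP.
move: PLR left_part right_part; set PL := P _; set PR := P [set w | (x1 <= X w)%R].
have PLf : PL = (fine PL)%:E by rewrite fineK// fin_num_measure.
have PRf : PR = (fine PR)%:E by rewrite fineK// fin_num_measure.
have I0 (E : set T) (g : T -> R) : 0 <= \int[P]_(w in E) (expR (g w))%:E.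
  by apply: integral_ge0 => w _; rewrite lee_fin expR_ge0.
rewrite PLf PRf.
have := I0 [set w | (X w < x1)%R] (q \o X); have := I0 [set w | (x1 <= X w)%R] (q \o X).
have := I0 [set w | (X w < x1)%R] (fun w => - f (X w))%R.
have := I0 [set w | (x1 <= X w)%R] (fun w => - f (X w))%R.
rewrite /=.
case: (\int[P]_(w in [set w | (X w < x1)%R]) (expR (q (X w)))%:E) => [a1| |]//;
case: (\int[P]_(w in [set w | (X w < x1)%R]) (expR (- f (X w)))%:E) => [a2| |]//;
case: (\int[P]_(w in [set w | (x1 <= X w)%R]) (expR (q (X w)))%:E) => [a3| |]//;
case: (\int[P]_(w in [set w | (x1 <= X w)%R]) (expR (- f (X w)))%:E) => [a4| |]//.
rewrite -!EFinM -!EFinD !lee_fin => _ _ _ _ [] h.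
(* The gain 67/6 p^2 on the left exceeds the loss 108/10 p^2 on the right. *)
have := sqr_ge0 p; lra.
Qed.

End near.

(** * The inequality for the rescaled variable *)

Lemma mule_le1_of_add_le2 (R : realType) (a b : \bar R) :
  (0 <= a -> 0 <= b -> a + b <= 2%:E -> a * b <= 1)%E.
Proof.
case: a => [a| |]//; case: b => [b| |]//; rewrite -EFinD -EFinM !lee_fin => a0 b0 ab.
have := sqr_ge0 (a - b); nra.
Qed.

Section product.
Context d (T : measurableType d) (R : realType) (P : probability T R).
Variables (X : {RV P >-> R}) (phi : R -> \bar R) (f q : R -> R).
Hypothesis nc : normalized_cost P X phi.
Hypothesis cf : cvx f.
Hypothesis cq : cvx q.
Hypothesis q_le : forall x y, ((q x)%:E <= (f y)%:E + phi (x - y)%R)%E.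
Local Open Scope ereal_scope.
Local Notation N := (log_tail (P := P) X).

Let mX : measurable_fun setT (X : T -> R). Proof. exact: measurable_funPT. Qed.

Let mexp (g : R -> R) : cvx g -> measurable_fun setT (fun w => (expR (g (X w)))%:E).
Proof.
move=> cg; apply/measurable_EFinP; apply: (measurableT_comp (@measurable_expR R)).
exact: cvx_measurable_comp.
Qed.

Let mexpN (g : R -> R) : cvx g -> measurable_fun setT (fun w => (expR (- g (X w)))%:E).
Proof.
move=> cg; apply/measurable_EFinP; apply: (measurableT_comp (@measurable_expR R)).
by apply: measurable_funN; exact: cvx_measurable_comp.
Qed.

(** Subtracting f x1 from both f and q leaves the product of the two integrals unchanged and makes
    the base value 0, as the additive form requires. *)
Lemma near_product (p x1 : R) :
  (0 <= p <= 1/100)%R -> (0 <= x1 <= 50)%R ->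
  (forall x, f x1 - p * (x - x1) <= f x)%R ->
  \int[P]_w (expR (q (X w)))%:E * \int[P]_w (expR (- f (X w)))%:E <= 1.
Proof.
move=> p01 x01 fp; pose c := f x1.
pose f' x := (f x - c)%R; pose q' x := (q x - c)%R.
have cf' : cvx f' by move=> x y t t01; have := cf x y t01; rewrite /f'; lra.
have cq' : cvx q' by move=> x y t t01; have := cq x y t01; rewrite /q'; lra.
have q'_le x y : (q' x)%:E <= (f' y)%:E + phi (x - y)%R.
  have := q_le x y; rewrite /q' /f'; have := nc_ge0 nc (x - y)%R.
  case: (phi _) => [v| |]// _; last by move=> _; rewrite addey// leey.
  by rewrite -!EFinD !lee_fin; lra.
have := near_normalized nc cf' cq' q'_le p01 x01 (subrr _).
move=> /(_ _)/wrap[]; first by move=> x; rewrite /f' /c; have := fp x; lra.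
have -> : \int[P]_w (expR (q (X w)))%:E = (expR c)%:E * \int[P]_w (expR (q' (X w)))%:E.
  rewrite -ge0_integralZl ?lee_fin ?expR_ge0//; last exact: mexp.
  by apply: eq_integral => w _; rewrite -EFinM -expRD; congr (expR _)%:E; rewrite /q'; lra.
have -> : \int[P]_w (expR (- f (X w)))%:E = (expR (- c))%:E * \int[P]_w (expR (- f' (X w)))%:E.
  rewrite -ge0_integralZl ?lee_fin ?expR_ge0//; last exact: mexpN.
  by apply: eq_integral => w _; rewrite -EFinM -expRD; congr (expR _)%:E; rewrite /f'; lra.
move=> h; rewrite muleACA -EFinM -expRD subrr expR0 mul1e.
by apply: mule_le1_of_add_le2 h; apply: integral_ge0 => w _; rewrite lee_fin expR_ge0.
Qed.

(** One fixed competitor z for all x; the factor 104/100 bounds E e^(N/100). *)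
Let integral_q_le (z k : R) :
  (forall x, phi (x - z)%R <= (1/100)%:E * N `|x|%R + k%:E) ->
  \int[P]_w (expR (q (X w)))%:E <= (expR (f z + k) * (104/100))%:E.
Proof.
move=> hphi.
have c0 : (0 <= 1/100 :> R)%R by lra.
have mJ : measurable_fun setT (tail_moment P X (1/100)) by exact: tail_moment_measurable.
have J0 w : 0 <= tail_moment P X (1/100) w by exact: expeR_ge0.
apply: (@le_trans _ _ (\int[P]_w ((expR (f z + k))%:E * tail_moment P X (1/100) w))).
  apply: ge0_le_integral => //.
  - exact: mexp.
  - exact: measurable_funeM.
  move=> w _; rewrite /tail_moment.
  rewrite (_ : (expR (f z + k))%:E = expeR (f z + k)%:E)// -expeRD.
  rewrite (_ : (expR _)%:E = expeR (q (X w))%:E)// lee_expeR.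
  apply: (le_trans (q_le (X w) z)); rewrite EFinD -addeA; apply: leeD => //.
  by rewrite addeC; exact: hphi.
rewrite ge0_integralZl// ?lee_fin ?expR_ge0// EFinM.
apply: lee_wpmul2l; first by rewrite lee_fin expR_ge0.
apply: (le_trans (@tail_moment_le _ _ _ P X (1/100)%R _)); first by apply/andP; split; lra.
by rewrite lee_fin; lra.
Qed.

Let N_half (u v : R) : (`|u| <= 2 * `|v|)%R -> N (`|u| / 840)%R <= (1/420)%:E * N `|v|%R.
Proof.
move=> uv; apply: (@le_trans _ _ (N (1/420 * `|v|)%R)); first by apply: log_tail_nd; lra.
by apply: (nc_scale nc); rewrite ?normr_ge0//; apply/andP; split; lra.
Qed.

Let phi_le (u v : R) : (`|u| <= 2 * `|v|)%R ->
  phi u <= (1/100)%:E * N `|v|%R + (1/5)%:E.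
Proof.
move=> uv; apply: (le_trans (nc_tail nc u)); apply: leeD => //.
apply: (@le_trans _ _ ((1/4)%:E * ((1/420)%:E * N `|v|%R))).
  by apply: lee_wpmul2l; [rewrite lee_fin; lra|exact: N_half].
rewrite muleA -EFinM; apply: lee_wpmul2r; first exact: log_tail_ge0.
by rewrite lee_fin; lra.
Qed.

(** B e^(-f(X)) is bounded pointwise by two different estimates of the constant B: competitor 50
    where X <= 50, and the point X itself where X > 50, which cancels f(X). *)
Lemma steep_product :
  (forall x, x <= 50 -> f 50 + (50 - x) / 100 <= f x)%R ->
  \int[P]_w (expR (q (X w)))%:E * \int[P]_w (expR (- f (X w)))%:E <= 1.
Proof.
move=> steep; set B := \int[P]_w (expR (q (X w)))%:E.
have c0 : (0 <= 1/100 :> R)%R by lra.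
have h0 : (0 <= 1/2 :> R)%R by lra.
have B1 : B <= (expR (f 50 + 1/5) * (104/100))%:E.
  apply: integral_q_le => x.
  have [x100|x100] := leP `|x - 50|%R 100%R.
    apply: (le_trans (nc_quad nc x100)).
    apply: (@le_trans _ _ (0 + (1/5)%:E)).
      rewrite add0e lee_fin; have : (((x - 50) / 100) ^+ 2 <= 1)%R.
        rewrite -[leLHS]ger0_norm ?sqr_ge0// normrX expr_le1//.
        by rewrite normrM (@ger0_norm _ 100^-1)//; lra.
      by lra.
    by apply: leeD => //; rewrite mule_ge0// ?lee_fin//; exact: log_tail_ge0.
  apply: phi_le; have := ler_normB x (50 : R)%R; have : (`|50 : R| = 50)%R by rewrite ger0_norm//; lra.
  lra.
have B0 : 0 <= B by apply: integral_ge0 => w _; rewrite lee_fin expR_ge0.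
(* |x - z| is at most twice the larger of |x| and |z|; when |z| is larger, the cost is absorbed by
   the constant n/100. *)
have Bn (z n : R) : N `|z|%R = n%:E -> B <= (expR (f z + (1/5 + n / 100)) * (104/100))%:E.
  move=> zn; apply: integral_q_le => x; rewrite EFinD.
  have n0 : (0 <= n)%R by rewrite -lee_fin -zn log_tail_ge0.
  have [zx|xz] := leP `|z|%R `|x|%R.
    have h : (`|x - z| <= 2 * `|x|)%R by have := ler_normB x z; lra.
    apply: (le_trans (phi_le h)); apply: leeD => //.
    by rewrite leeDl// lee_fin; lra.
  have h : (`|x - z| <= 2 * `|z|)%R by have := ler_normB x z; lra.
  apply: (le_trans (phi_le h)); rewrite zn -EFinM -!EFinD.
  rewrite -[leLHS]add0e; apply: leeD; last by rewrite lee_fin; lra.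
  by rewrite mule_ge0// ?lee_fin//; exact: log_tail_ge0.
move: B0 B1 Bn; case: B => [b| |]// b0; rewrite !lee_fin => B1 Bn.
have e15 : (expR (1/5) <= 5/4 :> R)%R.
  apply: (le_trans (expR_le_inv _)); first by lra.
  by rewrite (_ : 1 - 1/5 = (5/4)^-1)%R ?invrK//; field.
set D := [set w | (50 <= X w)%R].
have mD : measurable D by exact: measurable_ge.
have mf := mexpN cf.
have mJ2 : measurable_fun setT (tail_moment P X (1/2)) by exact: tail_moment_measurable.
have mJ1 : measurable_fun setT (tail_moment P X (1/100)) by exact: tail_moment_measurable.
have J1 c w : 0 <= tail_moment P X c w by exact: expeR_ge0.
(* From -f(X) <= -f(50) - 1/2 + X/100 and |X| - 1 <= N(|X|) everywhere. *)
pose k1 : R := (expR (- f 50 - 1/2 + 1/100))%R.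
(* Here n = N(X) >= X > 50, so n/100 <= n/2 - 20. *)
pose k2 : R := (104/100 * expR (1/5) * expR (-20))%R.
have k10 : 0 <= k1%:E by rewrite lee_fin expR_ge0.
have k20 : 0 <= k2%:E by rewrite lee_fin /k2 !mulr_ge0 ?expR_ge0//; lra.
have pt w : b%:E * (expR (- f (X w)))%:E <=
    (b * k1)%:E * tail_moment P X (1/100) w + k2%:E * tail_moment P X (1/2) w.
  have bk10 : 0 <= (b * k1)%:E by rewrite lee_fin mulr_ge0 ?expR_ge0.
  have [w50|w50] := leP (X w) 50%R.
    apply: (@le_trans _ _ ((b * k1)%:E * tail_moment P X (1/100) w)); last first.
      by rewrite leeDl// mule_ge0.
    rewrite EFinM -muleA; apply: lee_wpmul2l => //; rewrite /tail_moment.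
    rewrite (_ : k1%:E = expeR (- f 50 - 1/2 + 1/100)%:E)// -expeRD.
    rewrite (_ : (expR _)%:E = expeR (- f (X w))%:E)// lee_expeR.
    apply: (@le_trans _ _ ((- f 50 - 1/2 + 1/100)%:E + (1/100 * (`|X w| - 1))%:E)).
      rewrite -EFinD lee_fin; have := steep _ w50; have := ler_norm (X w); lra.
    apply: leeD => //; have [w1|w1] := leP `|X w|%R 1%R.
      apply: (@le_trans _ _ 0); first by rewrite lee_fin; lra.
      by rewrite mule_ge0// ?lee_fin//; exact: log_tail_ge0.
    apply: (@le_trans _ _ ((1/100)%:E * `|X w|%:E)); first by rewrite -EFinM lee_fin; lra.
    by apply: lee_wpmul2l => //; exact: (nc_lin nc).
  apply: (@le_trans _ _ (k2%:E * tail_moment P X (1/2) w)); last first.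
    by rewrite leeDr// mule_ge0.
  rewrite /tail_moment.
  have aw : `|X w|%R = X w by rewrite ger0_norm//; lra.
  have := nc_lin nc (_ : 1 < `|X w|)%R => /(_ _)/wrap[]; first by rewrite aw; lra.
  have := Bn (X w).
  case: (N `|X w|%R) => [n| |]//; last first.
    move=> _ _; rewrite gt0_muley ?lte_fin; last by lra.
    rewrite /= gt0_muley ?leey// lte_fin /k2 !mulr_gt0 ?expR_gt0//; lra.
  move=> /(_ n erefl); rewrite lee_fin aw => bn wn.
  rewrite -!EFinM /= -?EFinM lee_fin.
  apply: (@le_trans _ _ (expR (f (X w) + (1/5 + n/100)) * (104/100) * expR (- f (X w))))%R.
    by rewrite ler_wpM2r ?expR_ge0.
  rewrite (_ : expR (f (X w) + (1/5 + n/100)) * (104/100) * expR (- f (X w)) =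
    104/100 * (expR (f (X w)) * expR (- f (X w))) * expR (1/5) * expR (n/100))%R; last first.
    by rewrite !expRD; ring.
  rewrite -expRD subrr expR0 mulr1 /k2 -[leRHS]mulrA -expRD.
  have c0' : (0 <= 104/100 * expR (1/5) :> R)%R by rewrite mulr_ge0 ?expR_ge0//; lra.
  by apply: ler_wpM2l => //; rewrite ler_expR; rewrite lee_fin in wn; lra.
have mJJ1 : measurable_fun setT (fun w => (b * k1)%:E * tail_moment P X (1/100) w).
  exact: measurable_funeM.
have mJJ2 : measurable_fun setT (fun w => k2%:E * tail_moment P X (1/2) w).
  exact: measurable_funeM.
have bk10 : 0 <= (b * k1)%:E by rewrite lee_fin mulr_ge0 ?expR_ge0.
rewrite -ge0_integralZl//.
apply: (@le_trans _ _ (\int[P]_w ((b * k1)%:E * tail_moment P X (1/100) w +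
    k2%:E * tail_moment P X (1/2) w))).
  apply: ge0_le_integral => //.
  - by move=> w _; rewrite mule_ge0// lee_fin expR_ge0.
  - exact: measurable_funeM.
  - exact: emeasurable_funD.
rewrite ge0_integralD//; [|by move=> w _; rewrite mule_ge0|by move=> w _; rewrite mule_ge0].
rewrite ge0_integralZl// ge0_integralZl//.
apply: (@le_trans _ _ ((b * k1)%:E * (104/100)%:E + k2%:E * 3%:E)).
  apply: leeD; apply: lee_wpmul2l => //; last exact: tail_moment_half_le.
  apply: (le_trans (@tail_moment_le _ _ _ P X (1/100)%R _)); first by apply/andP; split; lra.
  by rewrite lee_fin; lra.
rewrite -!EFinM -EFinD lee_fin.
(* The exponent is 1/5 - 1/2 + 1/100. The main part is then about 0.84 and the part from X > 50
   below 0.01. *)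
have e29 : (expR (- (29/100)) <= 100/129 :> R)%R.
  apply: (le_trans (expR_le_inv _)); first by lra.
  by rewrite (_ : 1 - - (29/100) = (100/129)^-1)%R ?invrK//; field.
have bk1 : (b * k1 <= 104/100 * (100/129))%R.
  apply: (@le_trans _ _ (expR (f 50 + 1/5) * (104/100) * k1))%R.
    by rewrite ler_wpM2r// expR_ge0.
  rewrite (_ : expR (f 50 + 1/5) * (104/100) * k1 =
    104/100 * (expR (f 50 + 1/5) * k1))%R; last by ring.
  rewrite /k1 -expRD; apply: ler_wpM2l; first by lra.
  by apply: le_trans e29; rewrite ler_expR; lra.
have e20 : (expR (-20) <= (1/2) ^+ 10 :> R)%R.
  apply: (@le_trans _ _ (expR (- 10%:R))); first by rewrite ler_expR; lra.
  exact: expRN_le_pow.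
have k2le : (k2 <= 104/100 * (5/4) * (1/2) ^+ 10)%R.
  have a0 : (0 <= 104/100 * expR (1/5) :> R)%R by rewrite mulr_ge0 ?expR_ge0//; lra.
  have a1 : (104/100 * expR (1/5) <= 104/100 * (5/4) :> R)%R by lra.
  by apply: ler_pM => //; exact: expR_ge0.
by lra.
Qed.

(** Either the slope at 0 is at least -1/100, or the slope at 50 is at most -1/100 and the steep
    case applies, or the slope passes -1/100 somewhere in [0, 50]. *)
Lemma left_slope_product (s : R) : (s <= 0)%R ->
  (forall x, f 0 + s * (x - 0) <= f x)%R ->
  \int[P]_w (expR (q (X w)))%:E * \int[P]_w (expR (- f (X w)))%:E <= 1.
Proof.
move=> s0 hs; have [s1|s1] := leP (- (1/100))%R s.
  apply: (@near_product (- s)%R 0%R).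
  - by apply/andP; split; lra.
  - by apply/andP; split; lra.
  - by move=> x; have := hs x; lra.
have [s' hs'] := @subgradient R f 50 cf.
have [s'1|s'1] := leP s' (- (1/100))%R.
  apply: steep_product => x x50; apply: le_trans (hs' x).
  nra.
(* A minimizer of f(x) + x/100 on [0, 50] has -1/100 as a subgradient of f. Outside the interval
   this follows from s < -1/100 at 0 and s' > -1/100 at 50. *)
have [||x1 /[!in_itv]/= /andP[x10 x150] hmin] := @EVT_min R (fun x => f x + x / 100)%R 0 50.
- by lra.
- apply: continuous_subspaceT; apply: cvx_continuous => x y t t01.
  by have := cf x y t01; lra.
apply: (@near_product (1/100)%R x1).
- by apply/andP; split; lra.
- by apply/andP; split.
move=> x.
have g0 := hmin 0%R; have g50 := hmin 50%R; have gx := hmin x.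
move: g0 g50 gx; rewrite !in_itv/= => g0 g50 gx.
have [x0|x0] := ltP x 0%R.
  have := g0 _; rewrite lexx => /(_ _)/wrap[]; first by lra.
  have := hs x; nra.
have [x5|x5] := leP x 50%R.
  have := gx _; rewrite x0 x5 => /(_ isT); lra.
have := g50 _; rewrite lexx andbT => /(_ _)/wrap[]; first by lra.
have := hs' x; nra.
Qed.

End product.

Lemma normalized_product d (T : measurableType d) (R : realType) (P : probability T R)
    (X : {RV P >-> R}) (phi : R -> \bar R) (f q : R -> R) :
  normalized_cost P X phi -> cvx f -> cvx q ->
  (forall x y, ((q x)%:E <= (f y)%:E + phi (x - y)%R)%E) ->
  (\int[P]_w (expR (q (X w)))%:E * \int[P]_w (expR (- f (X w)))%:E <= 1)%E.
Proof.
move=> nc cf cq q_le.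
have [s hs] := subgradient 0 cf.
have [s0|s0] := leP s 0; first exact: (left_slope_product nc cf cq q_le s0 hs).
have q_le' x y : ((q (- x))%:E <= (f (- y))%:E + phi (x - y)%R)%E.
  by have := q_le (- x) (- y); rewrite (_ : - x - - y = - (x - y)) ?(nc_even nc)//; lra.
have s0' : - s <= 0 by lra.
have hs' x : f (- 0) + - s * (x - 0) <= f (- x) by have := hs (- x); rewrite oppr0; lra.
have := left_slope_product (normalized_costN nc) (cvx_opp cf) (cvx_opp cq) q_le' s0' hs'.
under eq_integral do rewrite /= opprK.
by under [X in (_ * X)%E]eq_integral do rewrite /= opprK.
Qed.

(** * The cost as a Legendre transform *)

(* [(1 + u/8)^8 + (1 - u/8)^8 >= 2 + 6/7 u^2], expanding binomially. *)
Lemma expR_add_expRN_ge (R : realType) (u : R) :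
  2 + 6/7 * u ^+ 2 <= expR u + expR (- u).
Proof.
wlog u0 : u / 0 <= u.
  move=> H; have [|/ltW u0] := leP 0 u; first exact: H.
  by have := H (- u); rewrite oppr_ge0 sqrrN opprK [expR (- u) + _]addrC; apply.
pose x := u / 8; have x0 : 0 <= x by rewrite /x; lra.
have -> : u ^+ 2 = 64 * x ^+ 2 by rewrite /x; field.
have pow8 (v : R) : expR (8 * v) = expR v ^+ 8 by rewrite -expRM_natl.
have ux : u = 8 * x by rewrite /x; field.
have e1 : (1 + x) ^+ 8 <= expR u.
  by rewrite ux pow8 lerXn2r ?nnegrE ?expR_ge0 ?expR_ge1Dx//; lra.
have x2 := sqr_ge0 x; have x3 : 0 <= x ^+ 3 by rewrite exprn_ge0.
have [xle|xgt] := leP x 1.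
  have e2 : (1 - x) ^+ 8 <= expR (- u).
    have -> : - u = 8 * (- x) by rewrite ux mulrN.
    have := expR_ge1Dx (- x) => h; rewrite pow8.
    by apply: lerXn2r => //; rewrite nnegrE ?expR_ge0//; lra.
  have E : (1 + x) ^+ 8 + (1 - x) ^+ 8 =
      2 + 56 * x ^+ 2 + 140 * x ^+ 4 + 56 * x ^+ 6 + 2 * x ^+ 8 by ring.
  have x4 : 0 <= x ^+ 4 by rewrite exprn_ge0.
  have x6 : 0 <= x ^+ 6 by rewrite exprn_ge0.
  have x8 : 0 <= x ^+ 8 by rewrite exprn_ge0.
  lra.
(* For x > 1 the base 1 - x is negative, but (1 + x)^8 alone is large enough. *)
have E : (1 + x) ^+ 8 = 1 + 8 * x + 28 * x ^+ 2 + 56 * x ^+ 3 +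
    70 * x ^+ 4 + 56 * x ^+ 5 + 28 * x ^+ 6 + 8 * x ^+ 7 + x ^+ 8 by ring.
have x4 : 0 <= x ^+ 4 by rewrite exprn_ge0.
have x5 : 0 <= x ^+ 5 by rewrite exprn_ge0.
have x6 : 0 <= x ^+ 6 by rewrite exprn_ge0.
have x7 : 0 <= x ^+ 7 by rewrite exprn_ge0.
have x8 : 0 <= x ^+ 8 by rewrite exprn_ge0.
have x23 : x ^+ 2 <= x ^+ 3 by rewrite exprS ler_peMl// ltW.
have := expR_ge0 (- u); lra.
Qed.

(** * Lower bounds on the moment generating function *)

Section mmt.
Context d (T : measurableType d) (R : realType) (P : probability T R).
Variable X : {RV P >-> R}.
Hypothesis symX : symmetric_RV X.
Local Open Scope ereal_scope.
Local Notation M := (mmt_gen_fun P X).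

Let mX : measurable_fun setT (X : T -> R). Proof. exact: measurable_funPT. Qed.

Let mabsX : measurable_fun setT (fun w => `|X w|%R).
Proof. exact: measurableT_comp. Qed.

Let mexp (y : R) : measurable_fun setT (fun w => (expR (y * X w))%:E).
Proof.
apply/measurable_EFinP; apply: (measurableT_comp (@measurable_expR R)).
exact: measurable_funM.
Qed.

Let mmtE y : M y = \int[P]_w (expR (y * X w))%:E.
Proof.
rewrite /mmt_gen_fun unlock; apply: eq_integral => w _ /=.
by rewrite mulrC.
Qed.

Lemma symmetric_ge t : P [set w | (t <= X w)%R] = P [set w | (t <= - X w)%R].
Proof.
have mA : measurable [set x : R | (t <= x)%R].
  by apply: upset_measurable => x y /=; exact: le_trans.
exact: symX mA.
Qed.

Lemma mmt_even y : M (- y)%R = M y.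
Proof.
rewrite !mmtE.
have mf : measurable_fun setT (fun x : R => (expR (y * x))%:E).
  apply/measurable_EFinP; apply: (measurableT_comp (@measurable_expR R)).
  exact: mulrl_measurable.
have f0 (x : R) : 0 <= (expR (y * x))%:E by rewrite lee_fin expR_ge0.
have mN : measurable_fun setT (\- X)%R by exact: measurable_funN.
have -> : \int[P]_w (expR (- y * X w))%:E =
    \int[pushforward P (\- X)%R]_x (expR (y * x))%:E.
  rewrite ge0_integral_pushforward//.
  by apply: eq_integral => w _ /=; rewrite mulrN mulNr.
have <- : \int[distribution P X]_x (expR (y * x))%:E = \int[P]_w (expR (y * X w))%:E.
  exact: (ge0_integral_distribution (X : {RV P >-> R}) mf f0).
by apply: eq_measure_integral => A mA _; exact/esym/symX.
Qed.

(** By symmetry 2 M(y) = E[e^(yX) + e^(-yX)] >= 2 + 6/7 y^2 E X^2, and Markov's inequality bounds E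
    X^2 below by t^2 r. *)
Lemma mmt_ge_quad (y t r : R) : (0 <= t)%R -> (0 <= r)%R ->
  r%:E <= P [set w | (t <= `|X w|)%R] ->
  (1 + 3/7 * (y ^+ 2 * t ^+ 2 * r))%:E <= M y.
Proof.
move=> t0 r0 rP; set c := (6/7 * (y ^+ 2 * t ^+ 2))%R.
have yt0 : (0 <= y ^+ 2 * t ^+ 2)%R by apply: mulr_ge0; exact: sqr_ge0.
have c0 : (0 <= c)%R by rewrite /c; lra.
set D := [set w | (t <= `|X w|)%R].
have mD : measurable D by exact: measurable_ge.
have e0 (u : R) : 0 <= (expR u)%:E by rewrite lee_fin expR_ge0.
pose I (w : T) : \bar R := (\1_D w)%:E.
have I0 w : 0 <= I w by rewrite lee_fin.
have mI : measurable_fun setT I by apply/measurable_EFinP; exact/measurable_indicP.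
have two0 : 0 <= 2%:E :> \bar R by rewrite lee_fin; lra.
have h : (2 + c * r)%:E <= M y + M y.
  rewrite -{1}(mmt_even y) !mmtE -ge0_integralD//.
  apply: (@le_trans _ _ (\int[P]_w (2%:E + c%:E * I w))); last first.
    apply: ge0_le_integral => //.
    - by move=> w _; rewrite adde_ge0// mule_ge0.
    - by apply: emeasurable_funD => //; exact: measurable_funeM.
    - exact: emeasurable_funD.
    move=> w _; rewrite -EFinM -!EFinD lee_fin.
    have := expR_add_expRN_ge (y * X w); rewrite mulNr.
    rewrite /D indicE; have [wD|wD] := boolP (w \in [set w | (t <= `|X w|)%R]); last first.
      by rewrite mulr0; have := sqr_ge0 (y * X w)%R; lra.
    move: wD; rewrite inE/= => tw; rewrite mulr1.
    have : (t ^+ 2 <= X w ^+ 2)%R by rewrite -[leRHS]real_normK ?num_real// lerXn2r ?nnegrE.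
    have := sqr_ge0 y => y2 tX.
    have : (y ^+ 2 * t ^+ 2 <= y ^+ 2 * X w ^+ 2)%R by rewrite ler_wpM2l.
    rewrite exprMn /c; lra.
  rewrite ge0_integralD//; last 2 first.
  - by move=> w _; rewrite mule_ge0.
  - exact: measurable_funeM.
  rewrite prob_integral_cst// prob_setT mule1 ge0_integralZl// EFinD EFinM.
  apply: leeD => //; apply: lee_wpmul2l => //.
  by rewrite /I integral_indic// setIT.
have M0 : 0 <= M y by rewrite mmtE; apply: integral_ge0.
move: h M0; case: (M y) => [m| |]//; last by move=> *; rewrite leey.
by rewrite -EFinD !lee_fin /c; lra.
Qed.

Lemma mmt_ge1 y : 1 <= M y.
Proof.
have := @mmt_ge_quad y 0 0 (lexx _) (lexx _).
by rewrite mulr0 mulr0 addr0; apply; exact: measure_ge0.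
Qed.

(** Markov's inequality for e^(yX), with the sign of y removed by evenness of M. *)
Lemma mmt_ge_exp (y t : R) : (expR (`|y| * t))%:E * P [set w | (t <= X w)%R] <= M y.
Proof.
wlog y0 : y / (0 <= y)%R.
  move=> H; have [|/ltW y0] := leP 0%R y; first exact: H.
  by have := H (- y)%R; rewrite normrN mmt_even oppr_ge0; exact.
rewrite ger0_norm// mmtE.
have mD : measurable [set w | (t <= X w)%R] by exact: measurable_ge.
rewrite -prob_integral_cst//.
apply: (@le_trans _ _ (\int[P]_(w in [set w | (t <= X w)%R]) (expR (y * X w))%:E)).
  apply: ge0_le_integral => //.
  - exact: measurable_funTS.
  - by move=> w /= tw; rewrite lee_fin ler_expR ler_wpM2l.
by apply: ge0_subset_integral => // w _; rewrite lee_fin expR_ge0.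
Qed.

End mmt.

Section legendre_cumulant.
Context d (T : measurableType d) (R : realType) (P : probability T R).
Variable X : {RV P >-> R}.
Hypothesis symX : symmetric_RV X.
Local Open Scope ereal_scope.
Local Notation L := (cumulant_gen_fun (P := P) X).

Lemma cumulant_ge0 y : 0 <= L y.
Proof. by rewrite /cumulant_gen_fun lne_ge0; exact: mmt_ge1. Qed.

Lemma cumulant_ge (y s : R) : (expR s)%:E <= mmt_gen_fun P X y -> s%:E <= L y.
Proof.
move=> h; rewrite /cumulant_gen_fun -[leLHS]expeRK lee_lne//= in_itv/= leey andbT.
  by rewrite lee_fin expR_ge0.
by apply: le_trans h; rewrite lee_fin expR_ge0.
Qed.

Lemma cumulant0 : L 0%R = 0.
Proof.
rewrite /cumulant_gen_fun /mmt_gen_fun unlock.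
under eq_integral do rewrite /= mulr0 expR0.
by rewrite prob_integral_cst// prob_setT mule1 lne1.
Qed.

Lemma legendre_ge0 x : 0 <= legendre L x.
Proof.
apply: ereal_sup_ubound; exists 0%R => //.
by rewrite mulr0 cumulant0 sube0.
Qed.

Lemma legendre_le x (r : \bar R) :
  (forall y, (x * y)%:E - L y <= r) -> legendre L x <= r.
Proof. by move=> h; apply: ge_ereal_sup => _ [y _ <-]. Qed.

Lemma legendre0 : legendre L 0%R <= 0.
Proof.
by apply: legendre_le => y; rewrite mul0r add0e oppe_le0; exact: cumulant_ge0.
Qed.

Lemma legendre_even x : legendre L (- x)%R = legendre L x.
Proof.
have H u : legendre L (- u)%R <= legendre L u.
  apply: legendre_le => y; apply: ereal_sup_ubound; exists (- y)%R => //.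
  by rewrite /cumulant_gen_fun mmt_even// mulrN mulNr.
by apply/le_anti; rewrite H -{1}(opprK x) H.
Qed.

(** A supremum of affine functions; where [L z] is infinite the term is -oo and nothing is to
    show. *)
Lemma legendre_convex : econvex_function setT (legendre L).
Proof.
move=> x y t _ _ /andP[t0 t1]; apply: legendre_le => z.
have t1' : (0 <= 1 - t)%R by lra.
have lx : (x * z)%:E - L z <= legendre L x by apply: ereal_sup_ubound; exists z.
have ly : (y * z)%:E - L z <= legendre L y by apply: ereal_sup_ubound; exists z.
have g0 : 0 <= t%:E * legendre L x + (1 - t)%:E * legendre L y.
  by rewrite adde_ge0// mule_ge0 ?lee_fin ?legendre_ge0.
case E : (L z) lx ly (cumulant_ge0 z) => [l| |]// lx ly _; last by rewrite addeNy leNye.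
apply: (@le_trans _ _ (t%:E * ((x * z)%:E - l%:E) + (1 - t)%:E * ((y * z)%:E - l%:E))).
  by rewrite -!EFinB -!EFinM -EFinD lee_fin; lra.
by apply: leeD; apply: lee_wpmul2l; rewrite ?lee_fin.
Qed.

End legendre_cumulant.

(** * Rescaling *)

Section log_concave.
Context d (T : measurableType d) (R : realType) (P : probability T R).
Variable X : {RV P >-> R}.
Hypothesis lcX : log_concave_tails (P := P) X.
Local Open Scope ereal_scope.
Local Notation N := (log_tail (P := P) X).

Let mX : measurable_fun setT (X : T -> R). Proof. exact: measurable_funPT. Qed.

Let mabsX : measurable_fun setT (fun w => `|X w|%R).
Proof. exact: measurableT_comp. Qed.

Let mNabsX : measurable_fun setT (fun w => - `|X w|)%R.
Proof. exact: measurable_funN. Qed.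

Lemma log_tail0 : N 0%R = 0.
Proof.
rewrite /log_tail (_ : [set w | _] = setT); first by rewrite prob_setT lne1 oppe0.
by apply/seteqP; split => w //= _; exact: normr_ge0.
Qed.

Lemma log_tail_scale (c t : R) : (0 <= c <= 1)%R -> (0 <= t)%R -> N (c * t)%R <= c%:E * N t.
Proof.
move=> c01 t0; have := lcX t0 (lexx 0%R) c01.
by rewrite mulr0 addr0 log_tail0 mule0 adde0.
Qed.

(** Convexity and N(0) = 0 give N(s) <= s/(s+t) N(s+t), and likewise for t; add the two. *)
Lemma log_tail_superadditive (s t : R) : (0 <= s)%R -> (0 <= t)%R -> N s + N t <= N (s + t)%R.
Proof.
move=> s0 t0; have [st0|st0] := eqVneq (s + t)%R 0%R.
  have -> : s = 0%R by lra.
  by rewrite (_ : t = 0)%R ?addr0 ?log_tail0 ?adde0//; lra.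
have st : (0 < s + t)%R by rewrite lt_neqAle eq_sym st0 addr_ge0.
have frac (u : R) : (0 <= u)%R -> (u <= s + t)%R -> N u <= (u / (s + t))%:E * N (s + t)%R.
  move=> u0 us; have := @log_tail_scale (u / (s + t)) (s + t).
  rewrite divfK//; apply; last exact: ltW.
  by rewrite divr_ge0 ?(ltW st)//= ler_pdivrMr// mul1r.
apply: (@le_trans _ _ ((s / (s + t))%:E * N (s + t)%R + (t / (s + t))%:E * N (s + t)%R)).
  by apply: leeD; apply: frac => //; lra.
rewrite -ge0_muleDl ?lee_fin ?divr_ge0 ?(ltW st)// -EFinD -mulrDl divff//.
by rewrite mul1e.
Qed.

Lemma tail_mul (s t : R) : (0 <= s)%R -> (0 <= t)%R ->
  P [set w | (s + t <= `|X w|)%R] <=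
  P [set w | (s <= `|X w|)%R] * P [set w | (t <= `|X w|)%R].
Proof.
move=> s0 t0; rewrite !tail_log_tail -expeRD lee_expeR.
have := log_tail_superadditive s0 t0.
have := log_tail_ge0 (P := P) X s; have := log_tail_ge0 (P := P) X t.
case: (N s) => [u| |]//; case: (N t) => [v| |]//; case: (N (s + t)%R) => [n| |]//.
- by rewrite /= -?EFinD !lee_fin; lra.
- by rewrite leNye.
Qed.

Let expN1_le (t : R) : N t <= 1 -> (1/3)%:E <= (expR (-1 : R))%:E /\
  (expR (-1 : R))%:E <= P [set w | (t <= `|X w|)%R].
Proof.
move=> Nt; split.
  rewrite lee_fin expRN (_ : 1/3 = 3^-1)%R; last by lra.
  by rewrite lef_pV2 ?posrE ?expR_gt0//; exact: expR1_le.
rewrite tail_log_tail (_ : (expR (-1))%:E = expeR (- 1%:E))//.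
by rewrite lee_expeR leeN2.
Qed.

(** The event |X| <= u is written through -|X| so that [prob_upset] can be applied to -|X|. *)
Let complement_le (s u : R) (c : R) : (u < s)%R -> c%:E <= P [set w | (s <= `|X w|)%R] ->
  P [set w | (- u <= - `|X w|)%R] <= (1 - c)%:E.
Proof.
move=> us cP.
have ms := measurable_ge s mabsX.
have mu := measurable_ge (- u)%R mNabsX.
have : P [set w | (s <= `|X w|)%R] + P [set w | (- u <= - `|X w|)%R] <= 1.
  rewrite -measureU//; first by apply: probability_le1; exact: measurableU.
  by apply/seteqP; split => // w [/=]; lra.
have Ps : P [set w | (s <= `|X w|)%R] = (fine (P [set w | (s <= `|X w|)%R]))%:E.
  by rewrite fineK// fin_num_measure.
have Pu : P [set w | (- u <= - `|X w|)%R] = (fine (P [set w | (- u <= - `|X w|)%R]))%:E.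
  by rewrite fineK// fin_num_measure.
by move: cP; rewrite Ps Pu -EFinD !lee_fin; lra.
Qed.

(** The scale is a = sup {t : N t <= 1}. Left continuity of the tail gives P(|X| >= a) >= 1/e >=
    1/3, and N > 1 beyond a spreads to linear growth by convexity. *)
Lemma unit_scale (t0 : R) : (0 < t0)%R -> 0 < P [set w | (t0 <= `|X w|)%R] ->
  exists a : R, [/\ (0 < a)%R, (1/3)%:E <= P [set w | (a <= `|X w|)%R] &
    forall t, (a < t)%R -> (t / a)%:E <= N t].
Proof.
move=> t00 Pt0; pose S := [set t : R | (0 <= t)%R /\ N t <= 1].
have S0 : S 0%R by split => //; rewrite log_tail0 lee01.
have c1 : (0 <= 1 - expR (-1) :> R)%R.
  by rewrite subr_ge0 -[leRHS](@expR0 R) ler_expR; lra.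
have ubS : has_ubound S.
  (* If S were unbounded, P(|X| <= u) would stay below 1 - 1/e for every u. *)
  apply: contrapT => nb.
  have big t : N t <= 1.
    have [//|Nt] := leP (N t) 1; exfalso; apply: nb; exists t => s [s0 Ns].
    rewrite leNgt; apply/negP => /ltW ts.
    by have := lt_le_trans Nt (log_tail_nd X ts); rewrite ltNge Ns.
  have : P ((fun w => - `|X w|)%R @^-1` setT) <= (1 - expR (-1))%:E.
    apply: prob_upset => // t _; rewrite -[t]opprK.
    by apply: (@complement_le (- t + 1)%R); [lra|exact: (expN1_le (big _)).2].
  rewrite preimage_setT prob_setT lee_fin; have := expR_gt0 (-1 : R); lra.
have supS : has_sup S by split => //; exists 0%R.
pose a := sup S.
have leS t : S t -> (t <= a)%R by move=> St; apply: ub_le_sup.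
have nN t : (0 <= t)%R -> (a < t)%R -> 1 < N t.
  move=> tge at_; rewrite ltNge; apply/negP => Nt.
  by have := leS t (conj tge Nt); rewrite leNgt at_.
(* With n = N(t0) finite, t0/(n + 1) is a positive element of S. *)
have a0 : (0 < a)%R.
  have [n Nt0] : exists n : R, N t0 = n%:E.
    have := log_tail_ge0 (P := P) X t0; have := Pt0; rewrite tail_log_tail.
    by case: (N t0) => [n _ _| /=|//]; [exists n|rewrite ltxx].
  have n0 : (0 <= n)%R by rewrite -lee_fin -Nt0 log_tail_ge0.
  have n1 : (0 < n + 1)%R by lra.
  apply: (@lt_le_trans _ _ ((n + 1)^-1 * t0)%R); first by rewrite mulr_gt0 ?invr_gt0.
  apply: leS; split; first by apply: mulr_ge0; [rewrite invr_ge0|]; exact: ltW.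
  apply: (@le_trans _ _ ((n + 1)^-1%:E * N t0)).
    apply: log_tail_scale; last exact: ltW.
    by rewrite invr_ge0 ltW//= invf_le1//; lra.
  by rewrite Nt0 -EFinM lee_fin mulrC ler_pdivrMr ?mul1r//; lra.
exists a; split => //.
- have : P ((fun w => - `|X w|)%R @^-1` [set t | (- a < t)%R]) <= (1 - expR (-1))%:E.
    apply: prob_upset => //; first by move=> x y /= ax xy; exact: lt_le_trans ax xy.
    move=> t /= at_; rewrite -[t]opprK.
    have d0 : (0 < a + t)%R by lra.
    have [s Ss] := sup_adherent d0 supS; rewrite -/a => hs.
    by apply: (@complement_le s); [lra|exact: (expN1_le Ss.2).2].
  have ma := measurable_ge a mabsX.
  have -> : (fun w => - `|X w|)%R @^-1` [set t | (- a < t)%R] = ~` [set w | (a <= `|X w|)%R].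
    by apply/seteqP; split => w /=; rewrite ltrN2 ltNge => /negP.
  rewrite probability_setC//.
  have -> : P [set w | (a <= `|X w|)%R] = (fine (P [set w | (a <= `|X w|)%R]))%:E.
    by rewrite fineK// fin_num_measure.
  have := (expN1_le S0.2).1.
  by rewrite -EFinB !lee_fin; lra.
move=> t at_; have t0' : (0 < t)%R by lra.
have := nN t (ltW t0') at_.
case E : (N t) => [n| |]//; last by move=> _; rewrite leey.
(* If n = N t < t/a, then t/n > a although N(t/n) <= N(t)/n = 1. *)
rewrite lte_fin lee_fin => n1; rewrite leNgt; apply/negP => nt.
have n0 : (0 < n)%R by lra.
have : 1 < N (t / n)%R.
  by apply: nN; [rewrite divr_ge0 ?ltW|rewrite ltr_pdivlMr// mulrC -ltr_pdivlMr].
rewrite ltNge => /negP; apply.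
rewrite mulrC; apply: (@le_trans _ _ (n^-1%:E * N t)).
  apply: log_tail_scale; last exact: ltW.
  by rewrite invr_ge0 ltW//= invf_le1// ltW.
by rewrite E -EFinM mulVf ?gt_eqF.
Qed.

End log_concave.

(** * Cost bounds in the scale a, and the conclusion for X *)

Section normalization.
Context d (T : measurableType d) (R : realType) (P : probability T R).
Variable X : {RV P >-> R}.
Hypothesis symX : symmetric_RV X.
Hypothesis lcX : log_concave_tails (P := P) X.
Variable b : R.
Hypothesis bE : b = 3360.
Local Open Scope ereal_scope.
Local Notation N := (log_tail (P := P) X).
Local Notation L := (cumulant_gen_fun (P := P) X).

Let mX : measurable_fun setT (X : T -> R). Proof. exact: measurable_funPT. Qed.

Let b0 : (0 < b)%R. Proof. by rewrite bE; lra. Qed.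

(** In terms of xi = x/b and u = a y it suffices that M(y) >= e^(xi u - 2 xi^2), since 2 <= 252/125.
    For |u| <= 4 the quadratic bound M >= 1 + u^2/7 is used, for larger |u| the bound M >= e^|u| /
    6. *)
Let legendre_quad (a x : R) : (0 < a)%R -> (1/3)%:E <= P [set w | (a <= `|X w|)%R] ->
  (`|x| <= 100)%R -> legendre L (a * x / b)%R <= ((x / 100) ^+ 2 / 560)%:E.
Proof.
move=> a0 Pa x100; apply: legendre_le => y.
pose xi := (x / b)%R; pose u := (a * y)%R.
have xyE : (a * x / b * y = xi * u)%R by rewrite /xi /u; ring.
have xi1 : (`|xi| <= 5/168)%R.
  by rewrite /xi normrM normfV (gtr0_norm b0) ler_pdivrMr// bE; lra.
have -> : ((x / 100) ^+ 2 / 560 = 252/125 * xi ^+ 2)%R by rewrite /xi bE; field.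
suff : (expR (xi * u - 2 * xi ^+ 2))%:E <= mmt_gen_fun P X y.
  move=> /cumulant_ge; rewrite xyE.
  have xi2 := sqr_ge0 xi.
  case: (L y) => [l| |]//; last by rewrite addeNy leNye.
  by rewrite -EFinB !lee_fin; lra.
have xi20 := sqr_ge0 xi.
have xiu : (xi * u <= 5/168 * `|u|)%R.
  by apply: (le_trans (ler_norm _)); rewrite normrM ler_wpM2r.
have [u4|u4] := leP `|u|%R 4%R.
  have quad : (1 + u ^+ 2 / 7)%:E <= mmt_gen_fun P X y.
    have := @mmt_ge_quad _ _ _ P X symX y a (1/3)%R (ltW a0) _ Pa.
    rewrite (_ : 3/7 * (y ^+ 2 * a ^+ 2 * (1/3)) = u ^+ 2 / 7)%R; last by rewrite /u; field.
    by apply; lra.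
  apply: le_trans quad; rewrite lee_fin.
  have u20 := sqr_ge0 u.
  (* For |u| <= 1, xi u - 2 xi^2 <= u^2/8; for 1 < |u| <= 4, the exponent is at most 4 * 5/168 =
     5/42. *)
  have [u1|u1] := leP `|u|%R 1%R.
    have u2 : (u ^+ 2 <= 1)%R by rewrite -real_normK ?num_real// expr_le1.
    apply: (@le_trans _ _ (expR (u ^+ 2 / 8))).
      rewrite ler_expR; have := sqr_ge0 (2 * xi - u / 2); nra.
    apply: (le_trans (expR_le_inv _)); first lra.
    by rewrite -[leLHS]mul1r ler_pdivrMr; [nra|lra].
  have u2 : (1 <= u ^+ 2)%R by rewrite -real_normK ?num_real// expr_ge1// ltW.
  apply: (@le_trans _ _ (expR (5/42))); first by rewrite ler_expR; lra.
  apply: (le_trans (expR_le_inv _)); first lra.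
  by rewrite -[leLHS]mul1r ler_pdivrMr; lra.
have e := mmt_ge_exp symX y a; apply: le_trans e.
have ma := measurable_ge a mX.
have P6 : (1/6)%:E <= P [set w | (a <= X w)%R].
  have abs : P [set w | (a <= `|X w|)%R] = P [set w | (a <= X w)%R] + P [set w | (a <= X w)%R].
    exact: prob_abs_ge mX a0 (symmetric_ge symX a).
  move: Pa; rewrite abs; have -> : P [set w | (a <= X w)%R] = (fine (P [set w | (a <= X w)%R]))%:E.
    by rewrite fineK// fin_num_measure.
  by rewrite -EFinD !lee_fin; lra.
apply: (@le_trans _ _ ((expR (`|y| * a))%:E * (1/6)%:E)); last first.
  by apply: lee_wpmul2l => //; rewrite lee_fin expR_ge0.
have uE : (`|y| * a = `|u|)%R by rewrite /u normrM (gtr0_norm a0) mulrC.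
rewrite uE -EFinM lee_fin.
have -> : expR `|u| = (expR (163/168 * `|u|) * expR (5/168 * `|u|))%R.
  by rewrite -expRD; congr expR; lra.
have e6 : (6 <= expR (163/168 * `|u|))%R.
  apply: (@le_trans _ _ (expR (2%:R * 1))); last by rewrite ler_expR; lra.
  rewrite expRM_natl; apply: (@le_trans _ _ ((5/2) ^+ 2)%R); first lra.
  by apply: lerXn2r; rewrite ?nnegrE ?expR_ge0 ?expR1_ge//; lra.
have ee : (expR (xi * u - 2 * xi ^+ 2) <= expR (5/168 * `|u|))%R by rewrite ler_expR; lra.
have := expR_ge0 (5/168 * `|u|)%R; nra.
Qed.

(** Since 3360 = 4 * 840, the linear term is at most |y| t / 4. As P(X >= t) >= e^(-N(t)) / 2, L(y)
    >= |y| t - N(t) - 4/5; a quarter of this, with L(y) >= 0, gives the bound. *)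
Let legendre_tail (a x : R) : (0 < a)%R ->
  legendre L (a * x / b)%R <= (1/4)%:E * N (a * (`|x| / 840))%R + (1/5)%:E.
Proof.
move=> a0; set t := (a * (`|x| / 840))%R; apply: legendre_le => y.
have i840 : (0 <= 840^-1 :> R)%R by lra.
have t0 : (0 <= t)%R by apply: mulr_ge0; [exact: ltW|exact: mulr_ge0 (normr_ge0 x) i840].
have l0 := cumulant_ge0 symX y; have n0 := log_tail_ge0 (P := P) X t.
have bI : (b^-1 = 840^-1 * 4^-1)%R by rewrite bE; field.
have xy : (a * x / b * y <= `|y| * t / 4)%R.
  have -> : (`|y| * t / 4 = a * `|x| / b * `|y|)%R by rewrite /t bI; ring.
  have -> : (a * `|x| / b * `|y| = a / b * `|x * y|)%R by rewrite normrM; ring.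
  have -> : (a * x / b * y = a / b * (x * y))%R by ring.
  by apply: ler_wpM2l; [apply: divr_ge0; exact: ltW|exact: ler_norm].
case E : (N t) n0 => [n| |]// n0; last first.
  by rewrite gt0_muley ?leey// ?lte_fin; lra.
have e2 : (2 <= expR (4/5) :> R)%R.
  have -> : (4/5 = 4%:R * (1/5) :> R)%R by lra.
  rewrite expRM_natl; apply: (@le_trans _ _ ((6/5) ^+ 4)%R); first lra.
  have := expR_ge1Dx (1/5 : R) => h.
  by apply: lerXn2r; rewrite ?nnegrE ?expR_ge0//; lra.
have mt := measurable_ge t mX.
have mt' := measurable_ge t (measurable_funN mX).
have Pt : (expR (- n - 4/5))%:E <= P [set w | (t <= X w)%R].
  (* A union bound, because t = 0 is possible and the two events then overlap. *)
  have : P [set w | (t <= `|X w|)%R] <= P [set w | (t <= X w)%R] + P [set w | (t <= X w)%R].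
    rewrite [in X in _ + X](symmetric_ge symX).
    apply: le_trans (measureU2 P mt mt'); apply: le_measure; rewrite ?inE.
    - by apply: measurable_ge; exact: measurableT_comp.
    - exact: measurableU.
    - by move=> w /=; rewrite ler_normr => /orP.
  rewrite tail_log_tail E.
  have -> : P [set w | (t <= X w)%R] = (fine (P [set w | (t <= X w)%R]))%:E.
    by rewrite fineK// fin_num_measure.
  rewrite /= -EFinD !lee_fin => h.
  have h2 : expR (- n) = (expR (- n - 4/5) * expR (4/5))%R.
    by rewrite -expRD; congr expR; lra.
  have := ler_wpM2l (expR_ge0 (- n - 4/5)) e2; lra.
have := @cumulant_ge _ _ _ P X y (`|y| * t + (- n - 4/5))%R.
move=> /(_ _)/wrap[].
  apply: le_trans (mmt_ge_exp symX y t).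
  by rewrite expRD EFinM; apply: lee_wpmul2l => //; rewrite lee_fin expR_ge0.
move: l0; case: (L y) => [l| |]//; last by rewrite addeNy leNye.
by rewrite -EFinM -EFinB -EFinD !lee_fin; lra.
Qed.

Lemma rescaled_normalized_cost (a : R) (Y : {RV P >-> R}) : (0 < a)%R ->
  (1/3)%:E <= P [set w | (a <= `|X w|)%R] ->
  (forall t, (a < t)%R -> (t / a)%:E <= N t) ->
  (forall w, Y w = X w / a)%R ->
  normalized_cost P Y (fun x => legendre L (a * x / b)%R).
Proof.
move=> a0 Pa lin YE.
have a0' := ltW a0.
have absE t : [set w | (t <= `|Y w|)%R] = [set w | (a * t <= `|X w|)%R].
  apply/seteqP; split => w /=; rewrite YE normrM normfV (gtr0_norm a0).
    by rewrite ler_pdivlMr// mulrC.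
  by rewrite ler_pdivlMr// mulrC.
have NE t : log_tail (P := P) Y t = N (a * t)%R by rewrite /log_tail absE.
split.
- move=> t.
  have -> : [set w | (t <= Y w)%R] = [set w | (a * t <= X w)%R].
    by apply/seteqP; split => w /=; rewrite YE ler_pdivlMr// mulrC.
  have -> : [set w | (t <= - Y w)%R] = [set w | (a * t <= - X w)%R].
    by apply/seteqP; split => w /=; rewrite YE -mulNr ler_pdivlMr// mulrC.
  exact: symmetric_ge.
- move=> s t s0 t0; rewrite !absE mulrDr; apply: tail_mul => //; exact: mulr_ge0.
- by rewrite absE mulr1 (_ : 3^-1 = 1/3)%R//; lra.
- move=> t t1; have at1 : (a < a * t)%R by rewrite ltr_pMr.
  by have := lin _ at1; rewrite NE (_ : a * t / a = t)%R//; field; rewrite gt_eqF.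
- move=> c t c01 t0; rewrite !NE mulrCA; apply: log_tail_scale => //; exact: mulr_ge0.
- by move=> x; exact: legendre_ge0.
- by move=> x; rewrite mulrN mulNr legendre_even.
- move=> x y t Dx Dy t01; have := @legendre_convex _ _ _ P X symX
    (a * x / b)%R (a * y / b)%R t I I t01.
  by apply: le_trans; rewrite le_eqVlt; apply/orP; left; apply/eqP; congr legendre; ring.
- by move=> x x100; exact: legendre_quad.
- by move=> x; rewrite NE; exact: legendre_tail.
Qed.

Lemma convex_IC_of_log_concave_tails : convex_IC (P := P) X b.
Proof.
move=> f /convex_function_cvx cf bf.
set phi := fun x : R => legendre L (x / b)%R.
have phi_ge0 x : 0 <= phi x by exact: legendre_ge0.
have phi0 : phi 0%R <= 0 by rewrite /phi mul0r; exact: legendre0.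
have phi_cvx : econvex_function setT phi.
  move=> x y t Dx Dy t01; have := @legendre_convex _ _ _ P X symX
    (x / b)%R (y / b)%R t I I t01.
  by apply: le_trans; rewrite le_eqVlt; apply/orP; left; apply/eqP; congr legendre; ring.
pose q x := fine (inf_conv f phi x).
have qE x : inf_conv f phi x = (q x)%:E by exact: inf_conv_fin.
have cq : cvx q by exact: inf_conv_cvx.
have q_le x y : (q x)%:E <= (f y)%:E + phi (x - y)%R.
  by rewrite -qE; exact: inf_conv_le.
have -> : \int[P]_w expeR (inf_conv f phi (X w)) = \int[P]_w (expR (q (X w)))%:E.
  by apply: eq_integral => w _; rewrite qE.
have [[t0 [t00 Pt0]]|nX] := pselect (exists t : R, (0 < t)%R /\ 0 < P [set w | (t <= `|X w|)%R]).
  have [a [a0 Pa lin]] := unit_scale lcX t00 Pt0.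
  have mY : measurable_fun setT (fun w => X w / a)%R.
    by apply: measurable_funM.
  pose Y : {RV P >-> R} := HB.pack (fun w => X w / a)%R (@isMeasurableFun.Build _ _ _ _ _ mY).
  have nc := @rescaled_normalized_cost a Y a0 Pa lin (fun=> erefl).
  have cvx_scale (g : R -> R) : cvx g -> cvx (fun x => g (a * x)%R).
    move=> cg x y t t01; have := cg (a * x)%R (a * y)%R t t01.
    by apply: le_trans; rewrite le_eqVlt; apply/orP; left; apply/eqP; congr g; ring.
  have q_le' x y : (q (a * x)%R)%:E <= (f (a * y)%R)%:E + legendre L (a * (x - y) / b)%R.
    by have := q_le (a * x)%R (a * y)%R; rewrite /phi mulrBr.
  have aY w : (a * Y w = X w)%R by rewrite /= mulrC divfK// gt_eqF.
  have := normalized_product nc (cvx_scale f cf) (cvx_scale q cq) q_le'.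
  under eq_integral do rewrite aY.
  by under [X in _ * X]eq_integral do rewrite aY.
(* No scale exists: X = 0 almost surely, and the product is e^(q(0) - f(0)) <= 1. *)
have P0 : P [set w | (0 < `|X w|)%R] = 0.
  apply/le_anti; rewrite measure_ge0 andbT.
  apply: (@prob_upset _ _ _ _ (fun w => `|X w|)%R [set t | (0 < t)%R]) => //.
  - exact: measurableT_comp.
  - by move=> x y /= x0; exact: lt_le_trans.
  - by move=> t /= t0; rewrite leNgt; apply/negP => Pt; apply: nX; exists t.
have X0 : {ae P, forall w, X w = 0%R}.
  exists [set w | (0 < `|X w|)%R]; split => //.
    by apply: measurable_gt; exact: measurableT_comp.
  by move=> w /= h; rewrite normr_gt0; apply/eqP => E; apply: h.
have mexp (g : R -> R) : measurable_fun setT (g \o X) ->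
    measurable_fun setT (fun w => (expR (g (X w)))%:E).
  by move=> mg; apply/measurable_EFinP; exact: (measurableT_comp (@measurable_expR R) mg).
have const_int (g : R -> R) : measurable_fun setT (g \o X) ->
    \int[P]_w (expR (g (X w)))%:E = (expR (g 0%R))%:E.
  move=> mg; rewrite -[RHS]mule1 -(prob_setT P) -prob_integral_cst//.
  apply: ge0_ae_eq_integral => //.
  - exact: mexp.
  - by apply: filterS X0 => w -> _.
rewrite (const_int q (cvx_measurable_comp cq mX)).
rewrite (const_int (fun x => - f x)%R (measurable_funN (cvx_measurable_comp cf mX))).
rewrite -EFinM -expRD lee_fin -expR0 ler_expR.
have := q_le 0%R 0%R; rewrite subrr => h.
have : (q 0%R)%:E <= (f 0%R)%:E + 0 by apply: le_trans h _; exact: leeD.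
by rewrite adde0 lee_fin; lra.
Qed.

End normalization.

Unset Implicit Arguments.

Theorem theorem2p1 (R : realType) :
  exists beta : R,
    0 < beta <= 1680 * expR 1 /\
    forall (d : measure_display) (T : measurableType d) (P : probability T R)
           (X : {RV P >-> R}),
      symmetric_RV X -> log_concave_tails X -> convex_IC X beta.
Proof.
(* 5/2 <= e gives 1680 e >= 4200. *)
exists 3360; split; first by have := expR1_ge R; lra.
by move=> d T P X symX lcX; exact: (@convex_IC_of_log_concave_tails d T R P X symX lcX 3360 erefl).
Qed.
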